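(* Let $k$ be a field, $n \ge 4$, and let $G$ be a simple graph on the vertex set $\{1,\dots,n\}$. Then $I_G^2$ is a Cohen-Macaulay ideal if and only if $G$ is a cycle of length 4 or 5.
   Context: Let $S = k[x_1,\dots,x_n]$ be a polynomial ring. A simple graph here means a finite undirected graph without multiple edges, without loops and without isolated vertices (every vertex in $\{1,\dots,n\}$ belongs to an edge); so if $G$ is a cycle, it passes through all $n$ vertices. We write $\{i,j\}\in G$ if $\{i,j\}$ is an edge of $G$. For $i \ne j$ put $P_{ij} = (x_t \mid t \ne i,j)$, the prime ideal of $S$ generated by all variables other than $x_i,x_j$. Define $I_G = \bigcap_{\{i,j\}\in G} P_{ij}$; $I_G^m$ denotes the ordinary $m$-th power. An ideal $I$ of $S$ is called Cohen-Macaulay if $S/I$ is a Cohen-Macaulay ring. *)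

(* Defs.v *)
From HB Require Import structures.
From mathcomp Require Import all_boot all_algebra.
From mathcomp Require Import boolp classical_sets.
From mathcomp Require Import mpoly.

Set Implicit Arguments.
Unset Strict Implicit.
Unset Printing Implicit Defensive.

Import GRing.Theory.
Local Open Scope classical_set_scope.
Local Open Scope ring_scope.

Section Ideals.
Variable R : comNzRingType.
Implicit Types (I J P Q : set R) (s : seq R).

(* Unlike [idealr_closed] of ring_quotient, this allows the unit ideal, which
   is needed for [ideal_gen] below. *)
Definition is_ideal I : Prop :=
  [/\ I 0, forall x y, I x -> I y -> I (x + y) & forall a x, I x -> I (a * x)].

Definition ideal_gen (X : set R) : set R := smallest is_ideal X.

Definition ideal_pow I (m : nat) : set R :=
  ideal_gen [set x | exists2 f : 'I_m -> R,
                       (forall i, I (f i)) & x = \prod_(i < m) f i].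

Definition prime_ideal P : Prop :=
  idealr_closed (mem P) /\ prime_idealr_closed (mem P).

(* [idealr_closed] ideals are proper. *)
Definition maximal_ideal P : Prop :=
  idealr_closed (mem P) /\
  forall J, idealr_closed (mem J) -> P `<=` J -> J = P.

Definition noetherian : Prop :=
  forall I, is_ideal I -> exists s, I = ideal_gen [set` s].

Definition regular_sequence s : Prop :=
  (forall i, (i < size s)%N -> forall a,
     ideal_gen [set` take i s] (s`_i * a) -> ideal_gen [set` take i s] a) /\
  ~ ideal_gen [set` s] 1.

Definition regular_lengths I : set nat :=
  [set r | exists2 s, regular_sequence s & [set` s] `<=` I /\ size s = r].

Definition prime_chain_lengths P : set nat :=
  [set r | exists Q : nat -> set R,
     [/\ Q r = P, forall i, (i <= r)%N -> prime_ideal (Q i)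
       & forall i, (i < r)%N -> Q i `<` Q i.+1]].

Definition is_max (A : set nat) (d : nat) : Prop :=
  A d /\ forall m, A m -> (m <= d)%N.

Definition has_depth I (d : nat) : Prop := is_max (regular_lengths I) d.

Definition has_height P (h : nat) : Prop := is_max (prime_chain_lengths P) h.

End Ideals.

(* depth m = height m at every maximal ideal m (Eisenbud, Commutative Algebra,
   section 18.2); here depth m, the maximal length of a regular sequence in m,
   is the depth of the localization at m, and height m is its dimension. *)
Definition cohen_macaulay (R : comNzRingType) : Prop :=
  noetherian R /\
  forall m : set R, maximal_ideal m ->
    exists2 d, has_depth m d & has_height m d.

(* The quotient construction {ideal_quot J} takes proper ideals, bundled with
   their boolean membership predicate, as elements J of [idealr R]. *)
Definition cohen_macaulay_ideal (R : comNzRingType) (I : set R) : Prop :=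
  exists2 J : idealr R, I = [set x | x \in J] & cohen_macaulay {ideal_quot J}.

Section Graphs.
Variables (n : nat) (G : rel 'I_n).

Definition simple_graph : Prop :=
  [/\ ssrbool.symmetric G, irreflexive G & forall i, exists j, G i j].

(* [next c i] is the cyclic successor of i in c; it is i itself when i \notin c,
   hence the membership tests. *)
Definition is_cycle (l : nat) : Prop :=
  (3 <= l)%N /\
  exists c : seq 'I_n,
    [/\ size c = l, uniq c
      & forall i j, G i j = (i \in c) && (j == next c i)
                         || (j \in c) && (i == next c j)].

Variable k : fieldType.

Definition edge_prime (i j : 'I_n) : set {mpoly k[n]} :=
  ideal_gen [set 'X_t | t in [set t : 'I_n | (t != i) && (t != j)]].

Definition graph_ideal : set {mpoly k[n]} :=
  \bigcap_(e in [set e : 'I_n * 'I_n | G e.1 e.2]) edge_prime e.1 e.2.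

End Graphs.

Arguments edge_prime [n] k i j _.
Arguments graph_ideal [n] G k _.

(* Main.v *)
Require Import Defs.
From HB Require Import structures.
From mathcomp Require Import all_boot all_order all_algebra.
From mathcomp Require Import boolp classical_sets.
From mathcomp Require Import mpoly.
From mathcomp Require Import zify ring.

(* Monomials x^a with supp(a) not contained in an edge span I = I_G, so
   I^2 is a monomial ideal, contained in the intersection J of the squares of the
   edge primes.

   If S/I^2 is Cohen-Macaulay, its depth at the origin is at least 2, so
   sections of S/I^2 over the punctured spectrum extend.  Applied to monomial
   sections, this shows that no vertex has three neighbours and that two
   nonadjacent vertices have a common neighbour; on at least 4 vertices only the
   cycles of length 4 and 5 satisfy both.

   Conversely these cycles are 3-colourable, have diameter 2 and satisfy I^2 = J.
   At a maximal ideal m, Zariski's lemma gives monic polynomials P, Q with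
   P(t1), Q(t2) in m, where t1 (resp. t2) is the sum of the variables not of
   the first (resp. second) colour.  They form a regular sequence modulo the
   square of each edge prime, and also modulo J: the quotients for the different
   edges glue, because for every monomial x^a the edges whose squared prime misses
   x^a are connected to each other through shared vertices, the diameter being 2.
   Zariski's lemma also gives a chain of primes of length 2 below m.  That
   neither depth nor height exceeds 2 follows from the algebraic dependence of
   any three elements. *)

Set Implicit Arguments.
Unset Strict Implicit.
Unset Printing Implicit Defensive.
Import GRing.Theory.
Local Open Scope classical_set_scope.
Local Open Scope ring_scope.

(** * Ideals *)

(** Depth and height are compared at every maximal ideal and [k] is arbitrary, so a point need not
    have coordinates in [k]: this is why polynomials P(t1) and Q(t2) replace translated linear
    forms. They are regular on the whole ring, so no localization appears. Three colours suffice
    over every field because they are sent to the vectors (0, 1), (1, 0) and (1, 1), pairwise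
    independent even over two elements; hence t1 and t2 restrict to independent linear forms on the
    plane of each edge. The difficulty lies in the second element of the sequence. The first one is
    a nonzerodivisor modulo J as soon as it is one modulo each squared prime, but regularity of a
    pair does not pass to intersections; so the quotients found on the edges are compared
    coefficient by coefficient. Both implications are proved for any ring [R] with a surjection from
    S of kernel I^2, and the quotient ring is inserted only at the end. *)

Section IdealGen.
Variable R : comNzRingType.
Implicit Types (I J X Y : set R) (s : seq R) (x y z : R).

Lemma ideal_gen_ideal X : is_ideal (ideal_gen X).
Proof.
split=> [I [[]]//|x y hx hy I hI|a x hx I hI].
  have [[_ hD _] _] := hI; apply: hD; [exact: hx|exact: hy].
by have [[_ _ hM] _] := hI; apply: hM; exact: hx.
Qed.

Lemma sub_ideal_gen X : X `<=` ideal_gen X.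
Proof. by move=> x Xx I [_]; apply. Qed.

Lemma ideal_gen_min X I : is_ideal I -> X `<=` I -> ideal_gen X `<=` I.
Proof. by move=> hI XI x; apply. Qed.

Lemma ideal_genS X Y : X `<=` Y -> ideal_gen X `<=` ideal_gen Y.
Proof.
move=> XY; apply: ideal_gen_min (ideal_gen_ideal Y) _.
exact: subset_trans XY (@sub_ideal_gen Y).
Qed.

Lemma ideal_sum I (T : Type) (r : seq T) (P : pred T) (F : T -> R) :
  is_ideal I -> (forall i, P i -> I (F i)) -> I (\sum_(i <- r | P i) F i).
Proof. by case=> h0 hD _ hF; elim/big_ind: _. Qed.

Lemma ideal_mulr I a x : is_ideal I -> I x -> I (x * a).
Proof. by case=> _ _ hM Ix; rewrite mulrC; apply: hM. Qed.

Lemma idealN I x : is_ideal I -> I x -> I (- x).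
Proof. by case=> _ _ hM Ix; rewrite -mulN1r; apply: hM. Qed.

Lemma idealB I x y : is_ideal I -> I x -> I y -> I (x - y).
Proof. by move=> hI Ix Iy; have [_ hD _] := hI; apply: hD=> //; apply: idealN. Qed.

Lemma ideal_gen_nil x : ideal_gen [set` [::]] x <-> x = 0.
Proof.
split=> [|->]; last by case: (ideal_gen_ideal [set` [::]]).
apply: (@ideal_gen_min _ [set x : R | x = 0]); last by [].
by split=> //= [? ? -> ->|a ? ->]; rewrite ?addr0 ?mulr0.
Qed.

Lemma ideal_gen_cons y s x :
  ideal_gen [set` y :: s] x <-> exists a z, ideal_gen [set` s] z /\ x = a * y + z.
Proof.
split=> [|[a [z [sz ->]]]].
  apply: (@ideal_gen_min _ [set x : R | exists a z, ideal_gen [set` s] z /\ x = a * y + z]).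
    have [h0 hD hM] := ideal_gen_ideal [set` s].
    split=> /=.
    - by exists 0, 0; rewrite mul0r addr0.
    - move=> _ _ [a [z [sz ->]]] [b [t [st ->]]]; exists (a + b), (z + t).
      by split; [exact: hD|rewrite mulrDl addrACA].
    - move=> c _ [a [z [sz ->]]]; exists (c * a), (c * z).
      by split; [exact: hM|rewrite mulrDr mulrA].
  move=> z /=; rewrite inE => /orP[/eqP->|zs].
    exists 1, 0; rewrite mul1r addr0; split=> //.
    by case: (ideal_gen_ideal [set` s]).
  by exists 0, z; rewrite mul0r add0r; split=> //; apply: sub_ideal_gen.
have [h0 hD hM] := ideal_gen_ideal [set` y :: s].
apply: hD; first by apply: hM; apply: sub_ideal_gen; rewrite /= mem_head.
by apply: ideal_genS sz => t /= ts; rewrite inE ts orbT.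
Qed.

Lemma ideal_gen1 y x : ideal_gen [set` [:: y]] x <-> exists a, x = a * y.
Proof.
split=> [/ideal_gen_cons[a [z [/ideal_gen_nil-> ->]]]|[a ->]].
  by exists a; rewrite addr0.
by apply/ideal_gen_cons; exists a, 0; rewrite addr0; split=> //; apply/ideal_gen_nil.
Qed.

(* [idealr_closed] is stated with boolean membership and requires 1 to lie
   outside the set. *)
Lemma idealr_closedP I : idealr_closed (mem I) <-> is_ideal I /\ ~ I 1.
Proof.
split=> [[h0 h1 h]|[[h0 hD hM] h1]].
  move: h0 h1; rewrite inE => h0 /negP; rewrite inE => h1; split=> //.
  have hh a u v : I u -> I v -> I (a * u + v).
    by move=> Iu Iv; apply/set_mem; apply: h; rewrite inE.
  split=> // [x y Ix Iy|a x Ix].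
    by rewrite -[x]mul1r; apply: hh.
  by rewrite -[a * x]addr0; apply: hh.
split; first by rewrite inE.
  by apply/negP; rewrite inE.
by move=> a u v; rewrite !inE => Iu Iv; apply: hD=> //; apply: hM.
Qed.

Lemma prime_idealP I :
  prime_ideal I <->
  [/\ is_ideal I, ~ I 1 & forall x y, I (x * y) -> I x \/ I y].
Proof.
split=> [[/idealr_closedP[hI h1] hp]|[hI h1 hp]].
  split=> // x y Ixy; have := hp x y; rewrite inE => /(_ Ixy) /orP[]; rewrite inE; tauto.
split; first exact/idealr_closedP.
move=> x y; rewrite inE => /hp[h|h]; apply/orP; rewrite !inE; tauto.
Qed.

Lemma maximal_idealP I :
  maximal_ideal I <->
  [/\ is_ideal I, ~ I 1 & forall x, ~ I x -> exists a, I (a * x - 1)].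
Proof.
split=> [[/idealr_closedP[hI h1] hm]|[hI h1 hm]].
  split=> // x nIx; apply: contrapT => hx.
  have [h0 hD hM] := hI.
  pose J := [set y | exists a z, I z /\ y = a * x + z].
  suff JI : J = I.
    by apply: nIx; rewrite -JI; exists 1, 0; rewrite mul1r addr0.
  apply: hm; last first.
    by move=> z Iz; exists 0, z; rewrite mul0r add0r.
  apply/idealr_closedP; split; first split.
  - by exists 0, 0; rewrite mul0r addr0.
  - move=> _ _ [a [z [sz ->]]] [b [t [st ->]]]; exists (a + b), (z + t).
    by split; [exact: hD|rewrite mulrDl addrACA].
  - move=> c _ [a [z [sz ->]]]; exists (c * a), (c * z).
    by split; [exact: hM|rewrite mulrDr mulrA].
  move=> [a [z [Iz e1]]]; apply: hx; exists a.
  by rewrite e1 opprD addrA subrr add0r; apply: idealN.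
split; first exact/idealr_closedP.
move=> J /idealr_closedP[hJ nJ1] IJ; apply/seteqP; split=> // x Jx.
apply: contrapT => /hm[a /IJ Jax]; apply: nJ1.
have -> : 1 = a * x - (a * x - 1) by rewrite opprB addrC subrK.
by apply: idealB => //; case: hJ => _ _; apply.
Qed.

End IdealGen.

Lemma is_ideal_preim (R T : comNzRingType) (f : {rmorphism R -> T}) (J : set T) :
  is_ideal J -> is_ideal (f @^-1` J).
Proof.
case=> h0 hD hM; split=> /=; first by rewrite rmorph0.
  by move=> x y ? ?; rewrite rmorphD; apply: hD.
by move=> a x ?; rewrite rmorphM; apply: hM.
Qed.

(** * Transfer along surjective ring morphisms *)

Section Surj.
Variables (R T : comNzRingType) (f : {rmorphism R -> T}).
Hypothesis f_surj : forall y, exists x, f x = y.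

Lemma maximal_ideal_preim (J : set T) : maximal_ideal J -> maximal_ideal (f @^-1` J).
Proof.
move=> /maximal_idealP[hJ h1 hm]; apply/maximal_idealP; split.
- exact: is_ideal_preim.
- by rewrite /= rmorph1.
- move=> x /hm[b]; have [a <-] := f_surj b; rewrite -rmorphM -(rmorph1 f) -rmorphB.
  by exists a.
Qed.

Lemma noetherian_surj : noetherian R -> noetherian T.
Proof.
move=> nR I hI; have [s es] := nR _ (is_ideal_preim f hI).
exists (map f s); apply/seteqP; split.
  move=> y Iy; have [x ex] := f_surj y.
  have : (f @^-1` I) x by rewrite /= ex.
  rewrite es -ex.
  apply: (@ideal_gen_min _ _ (f @^-1` ideal_gen [set` map f s])).
    exact/is_ideal_preim/ideal_gen_ideal.
  by move=> z /= zs; apply: sub_ideal_gen; apply: map_f.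
apply: ideal_gen_min => // _ /mapP[x xs ->].
have : ideal_gen [set` s] x by apply: sub_ideal_gen.
by rewrite -es.
Qed.

End Surj.

(** * Regular sequences and dimension *)

Section Regular.
Variable R : comNzRingType.
Implicit Types (f g a b u : R) (K P : set R) (s : seq R).

(* The inductive form, due to Coquand and Lombardi, of Krull dimension at
   most 2: it bounds both the length of prime chains and of regular sequences. *)
Definition krull_dim_le2 : Prop := forall f0 f1 f2 : R,
  exists m0 m1 m2 a0 a1 a2,
    f0 ^+ m0 * (f1 ^+ m1 * (f2 ^+ m2 * (1 + a2 * f2) + a1 * f1) + a0 * f0) = 0.

Lemma nzd_exp K f m : (forall a, K (f * a) -> K a) -> forall a, K (f ^+ m * a) -> K a.
Proof.
move=> hf; elim: m => [|m IH] a; first by rewrite expr0 mul1r.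
by rewrite exprS -mulrA => /hf/IH.
Qed.

(** In a chain of length 3, choose [f_i] in [Q (i+1)] but not in [Q i], and peel the relation from
    the outside: modulo [Q i] the power of [f_i] cancels, modulo [Q (i+1)] the term [a_i f_i] drops.
    What remains is 1 in [Q 3]. The bound on regular sequences below peels in the same way, with the
    ideals of the initial segments. *)
Lemma krull_height P r : krull_dim_le2 -> prime_chain_lengths P r -> (r <= 2)%N.
Proof.
move=> hk [Q [_ hp hlt]]; rewrite leqNgt; apply/negP => r3.
have lt_ i : (i <= r)%N -> (i < 3)%N -> exists2 f, Q i.+1 f & ~ Q i f.
  move=> ir i3; have [sub nsub] := hlt i (leq_trans i3 r3).
  apply: contrapT => h; apply: nsub => f Qf; apply: contrapT => nQ; apply: h.
  by exists f.
have [||f0 Q1f0 nQ0] := lt_ 0%N; [by lia|by []|].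
have [||f1 Q2f1 nQ1] := lt_ 1%N; [by lia|by []|].
have [||f2 Q3f2 nQ2] := lt_ 2%N; [by lia|by []|].
have [m0 [m1 [m2 [a0 [a1 [a2 e]]]]]] := hk f0 f1 f2.
have pr i : (i <= 3)%N -> prime_ideal (Q i) by move=> i3; apply: hp; lia.
have cut i f m b : (i <= 3)%N -> ~ Q i f -> Q i (f ^+ m * b) -> Q i b.
  move=> /pr /prime_idealP[_ _ hq] nf; apply: nzd_exp => a /hq[]//.
have mono i : (i < 3)%N -> Q i `<=` Q i.+1.
  by move=> i3; have [] := hlt i (leq_trans i3 r3).
have drop i f a b : (i < 3)%N -> Q i.+1 f -> Q i (b + a * f) -> Q i.+1 b.
  move=> i3 Qf /(mono _ i3) h; have [I_ _ _] := (prime_idealP _).1 (pr i.+1 i3).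
  by rewrite -[b](addrK (a * f)); apply: idealB => //; case: I_ => _ _; apply.
have : Q 0%N (f0 ^+ m0 * (f1 ^+ m1 * (f2 ^+ m2 * (1 + a2 * f2) + a1 * f1) + a0 * f0)).
  by rewrite e; have [[]] := (prime_idealP _).1 (pr 0%N isT).
move=> /(cut 0%N f0)-/(_ isT nQ0) /(drop 0%N f0)-/(_ isT Q1f0).
move=> /(cut 1%N f1)-/(_ isT nQ1) /(drop 1%N f1)-/(_ isT Q2f1).
move=> /(cut 2%N f2)-/(_ isT nQ2) /(drop 2%N f2)-/(_ isT Q3f2).
by have [_] := (prime_idealP _).1 (pr 3%N isT).
Qed.

Lemma krull_depth s : krull_dim_le2 -> regular_sequence s -> (size s <= 2)%N.
Proof.
move=> hk [hreg h1]; rewrite leqNgt; apply/negP => s3.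
have [m0 [m1 [m2 [a0 [a1 [a2 e]]]]]] := hk s`_0 s`_1 s`_2.
have cut i m b : (i < 3)%N -> ideal_gen [set` take i s] (s`_i ^+ m * b) ->
    ideal_gen [set` take i s] b.
  move=> i3; apply: (@nzd_exp (ideal_gen [set` take i s])) => a.
  by apply: hreg; lia.
have drop i a b : (i < 3)%N -> ideal_gen [set` take i s] (b + a * s`_i) ->
    ideal_gen [set` take i.+1 s] b.
  move=> i3 h; have si : (i < size s)%N by lia.
  have hI := ideal_gen_ideal [set` take i.+1 s].
  rewrite -[b](addrK (a * s`_i)); apply: (idealB hI).
    apply: (ideal_genS _ h) => x /=; rewrite (take_nth 0 si) mem_rcons inE.
    by move=> ->; rewrite orbT.
  have [_ _ hM] := hI; apply: hM; apply: sub_ideal_gen.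
  by rewrite /= (take_nth 0 si) mem_rcons mem_head.
have : ideal_gen [set` take 0 s]
    (s`_0 ^+ m0 * (s`_1 ^+ m1 * (s`_2 ^+ m2 * (1 + a2 * s`_2) + a1 * s`_1) + a0 * s`_0)).
  by rewrite e; case: (ideal_gen_ideal [set` take 0 s]).
move=> /(cut 0%N)-/(_ isT) /(drop 0%N)-/(_ isT).
move=> /(cut 1%N)-/(_ isT) /(drop 1%N)-/(_ isT).
move=> /(cut 2%N)-/(_ isT) /(drop 2%N)-/(_ isT).
move=> h; apply: h1; apply: (ideal_genS _ h) => x /=; exact: mem_take.
Qed.

Lemma regular_sequence2 f g s : regular_sequence [:: f, g & s] ->
  (forall a, f * a = 0 -> a = 0) /\
  (forall a b, g * a = f * b -> exists c, a = f * c).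
Proof.
move=> [h _]; split=> [a fa|a b gab].
  have := h 0%N isT a; rewrite /= fa => ha.
  exact: (ideal_gen_nil a).1 (ha ((ideal_gen_nil 0).2 erefl)).
have := h 1%N isT a; rewrite /= => h1.
have /h1/ideal_gen1[c ec] : ideal_gen [set` [:: f]] (g * a).
  by apply/ideal_gen1; exists b; rewrite gab mulrC.
by exists c; rewrite mulrC.
Qed.

Lemma regular_sequence2P f g :
  (forall a, f * a = 0 -> a = 0) ->
  (forall a b, g * a = f * b -> exists c, a = f * c) ->
  ~ ideal_gen [set` [:: f; g]] 1 -> regular_sequence [:: f; g].
Proof.
move=> hf hg h1; split=> // -[|[|//]] _ a /=.
  by move=> /ideal_gen_nil/hf->; apply/ideal_gen_nil.
move=> /ideal_gen1[b]; rewrite [b * f]mulrC => /hg[c ->].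
by apply/ideal_gen1; exists c; rewrite mulrC.
Qed.

(** Extending sections requires a regular sequence inside the ideal of the [X_i ^+ N], which only
    powers of the given elements are known to reach. *)
Lemma regular_pow f g M M' : (forall a, f * a = 0 -> a = 0) ->
  (forall a b, g * a = f * b -> exists c, a = f * c) ->
  (forall a, f ^+ M * a = 0 -> a = 0) /\
  (forall a b, g ^+ M' * a = f ^+ M * b -> exists c, a = f ^+ M * c).
Proof.
move=> hf hg; split; first exact: (@nzd_exp [set x | x = 0]).
have h1 m a b : g * a = f ^+ m * b -> exists c, a = f ^+ m * c.
  elim: m a b => [|m IH] a b; first by exists a; rewrite mul1r.
  rewrite exprS -mulrA => /[dup] e /hg[c ec].
  move: e; rewrite {}ec mulrCA => /(congr1 (fun z => z - f * (f ^+ m * b))).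
  rewrite subrr -mulrBr => /hf/eqP; rewrite subr_eq0 => /eqP/IH[d ->].
  by exists d; rewrite mulrA.
move=> a b; elim: M' a b => [|m IH] a b.
  by rewrite mul1r; exists b.
by rewrite exprSr -mulrA => /IH[c /h1].
Qed.

(* A section b_i / y_i over the complement of the zero locus of the y_i
   extends: this is the vanishing of the first local cohomology module. *)
Lemma regular_glue f g (T : finType) (y b c d : T -> R) :
  (forall a, f * a = 0 -> a = 0) ->
  (forall a b, g * a = f * b -> exists c, a = f * c) ->
  f = \sum_i c i * y i -> g = \sum_i d i * y i ->
  (forall i j, y j * b i = y i * b j) ->
  exists u, forall i, y i * u = b i.
Proof.
move=> hf hg ef eg hb.
(* A solution [u] would satisfy [A = f * u] and [B = g * u]. *)
pose A := \sum_i c i * b i; pose B := \sum_i d i * b i.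
have eA j : y j * A = f * b j.
  rewrite ef mulr_suml mulr_sumr; apply: eq_bigr => i _.
  by rewrite mulrCA hb mulrA.
have : g * A = f * B.
  rewrite {1}eg mulr_suml /B mulr_sumr; apply: eq_bigr => i _.
  by rewrite -mulrA eA mulrCA.
move=> /hg[u eu]; exists u => j; apply/eqP; rewrite -subr_eq0; apply/eqP/hf.
by rewrite mulrBr mulrCA -eu eA subrr.
Qed.

End Regular.

(** * Hilbert's basis theorem *)

Section HilbertBasis.
Variable A : comNzRingType.
Implicit Types (p q : {poly A}) (d : nat).

Let L (I : set {poly A}) d : set A :=
  [set c | exists p, [/\ I p, (size p <= d.+1)%N & p`_d = c]].

Let L_ideal I d : is_ideal I -> is_ideal (L I d).
Proof.
case=> h0 hD hM; split=> [|x y [p [Ip sp <-]] [q [Iq sq <-]]|a x [p [Ip sp <-]]].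
- by exists 0; rewrite size_poly0 coef0.
- exists (p + q); rewrite coefD; split=> //; first exact: hD.
  by rewrite (leq_trans (size_polyD _ _)) // geq_max sp sq.
- exists (a%:P * p); rewrite coefCM; split=> //; first exact: hM.
  by rewrite mul_polyC (leq_trans (size_scale_leq _ _)).
Qed.

Let L_mono I d e : is_ideal I -> (d <= e)%N -> L I d `<=` L I e.
Proof.
case=> h0 hD hM de x [p [Ip sp <-]]; exists ('X^(e - d) * p); split.
- exact: hM.
- rewrite (leq_trans (size_polyMleq _ _)) // size_polyXn.
  by move: sp de; clear; lia.
- by rewrite coefXnM ltnNge leq_subr subKn.
Qed.

(** Combining lifts of the generators with constant coefficients keeps the degree at most [d]. *)
Let L_gen I d (s : seq A) : is_ideal I -> [set` s] `<=` L I d ->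
  exists2 T : seq {poly A}, [set` T] `<=` I &
    forall c, ideal_gen [set` s] c ->
      exists q, [/\ ideal_gen [set` T] q, (size q <= d.+1)%N & q`_d = c].
Proof.
move=> hI; elim: s => [|x s IH] hs.
  exists [::] => // c /ideal_gen_nil->; exists 0; rewrite size_poly0 coef0.
  by split=> //; apply/ideal_gen_nil.
have [T TI hT] : exists2 T : seq {poly A}, [set` T] `<=` I &
    forall c, ideal_gen [set` s] c ->
      exists q, [/\ ideal_gen [set` T] q, (size q <= d.+1)%N & q`_d = c].
  by apply: IH => y /= ys; apply: hs; rewrite /= inE ys orbT.
have [p [Ip sp ep]] : L I d x by apply: hs; rewrite /= mem_head.
exists (p :: T) => [q /=|c /ideal_gen_cons[a [z [/hT[q [Tq sq eq]] ->]]]].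
  by rewrite inE => /orP[/eqP->//|/TI].
exists (a%:P * p + q); split.
- by apply/ideal_gen_cons; exists a%:P, q.
- rewrite (leq_trans (size_polyD _ _)) // geq_max sq mul_polyC.
  by rewrite (leq_trans (size_scale_leq _ _)).
- by rewrite coefD coefCM ep eq.
Qed.

Theorem hilbert_basis : noetherian A -> noetherian {poly A}.
Proof.
move=> nA I hI.
have /choice[T TP] : forall d, exists T : seq {poly A}, [set` T] `<=` I /\
    forall c, L I d c ->
      exists q, [/\ ideal_gen [set` T] q, (size q <= d.+1)%N & q`_d = c].
  move=> d; have [s es] := nA _ (L_ideal d hI).
  have [|T TI hT] := @L_gen I d s hI; first by rewrite es; exact: sub_ideal_gen.
  by exists T; split=> // c; rewrite es => /hT.
(* The [L I d] increase with [d], so finitely many generators of their union already lie in a single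
   [L I N]. *)
have LU : is_ideal (\bigcup_d L I d).
  split=> [|x y [d _ xd] [e _ ye]|a x [d _ xd]].
  - by exists 0%N => //; case: (L_ideal 0 hI).
  - exists (maxn d e) => //; have [_ hD _] := L_ideal (maxn d e) hI.
    by apply: hD; [apply: L_mono xd|apply: L_mono ye]; rewrite ?leq_maxl ?leq_maxr.
  - by exists d => //; case: (L_ideal d hI) => _ _; apply.
have [s es] := nA _ LU.
have [N hN] : exists N, [set` s] `<=` L I N.
  have : [set` s] `<=` \bigcup_d L I d by rewrite es; exact: sub_ideal_gen.
  elim: (s) => [|x t IH] ht; first by exists 0%N.
  have [|M hM] := IH; first by move=> y /= yt; apply: ht; rewrite /= inE yt orbT.
  have [d _ xd] := ht x (mem_head _ _); exists (maxn d M) => y /=.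
  rewrite inE => /orP[/eqP->|/hM]; [apply: L_mono xd|apply: L_mono] => //.
    exact: leq_maxl.
  exact: leq_maxr.
have LN d : L I d `<=` L I N.
  move=> x xd; have : ideal_gen [set` s] x by rewrite -es; exists d.
  exact: (ideal_gen_min (L_ideal N hI) hN).
pose g := flatten [seq T d | d <- iota 0 N.+1].
have gI : ideal_gen [set` g] `<=` I.
  apply: ideal_gen_min => // p /flatten_mapP[d _ pT].
  by have [+ _] := TP d; apply.
have Tg d : (d <= N)%N -> ideal_gen [set` T d] `<=` ideal_gen [set` g].
  move=> dN; apply: ideal_genS => p /= pT; apply/flatten_mapP.
  by exists d => //; rewrite mem_iota.
exists g; apply/seteqP; split=> // p.
have [m] := ubnP (size p); elim: m p => // m IH p sp Ip.
have [->|p0] := eqVneq p 0; first by case: (ideal_gen_ideal [set` g]).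
have [q [gq sq eq]] : exists q, [/\ ideal_gen [set` g] q, (size q <= size p)%N
    & q`_(size p).-1 = lead_coef p].
  have sp1 : size p = (size p).-1.+1 by rewrite -polySpred.
  have Lp : L I (size p).-1 (lead_coef p) by exists p; rewrite -sp1.
  have [dN|dN] := leqP (size p).-1 N.
    have [_ /(_ _ Lp)[q [Tq sq eq]]] := TP (size p).-1.
    by exists q; rewrite [X in (_ <= X)%N]sp1; split=> //; apply: Tg Tq.
  (* Above degree [N] the leading coefficient is realised in degree [N] and shifted up by a power of
     ['X]. *)
  have [_ /(_ _ (LN _ _ Lp))[q [Tq sq eq]]] := TP N.
  exists ('X^((size p).-1 - N) * q); split.
  - have [_ _ hM] := ideal_gen_ideal [set` g].
    by apply: hM; apply: (Tg N (leqnn N)).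
  - have := size_polyMleq 'X^((size p).-1 - N) q; rewrite size_polyXn.
    by move: (size ('X^_ * q)) => t; move: sq dN; clear; lia.
  - rewrite coefXnM -eq; case: ltnP; first lia.
    by move=> _; congr (q`_ _); lia.
rewrite -[p](subrK q); have [_ hD _] := ideal_gen_ideal [set` g].
apply: hD => //; apply: IH; last by apply: idealB => //; apply: gI.
have p_gt0 : (0 < size p)%N by rewrite size_poly_gt0.
suff : (size (p - q)%R <= (size p).-1)%N by move: (size (p - q)%R) sp p_gt0; clear; lia.
apply/leq_sizeP => j hj.
rewrite coefB; case: (ltngtP j (size p).-1) hj => // [hj _|-> _].
  have sj : (size p <= j)%N by rewrite -(prednK p_gt0).
  by rewrite (nth_default _ sj) (nth_default _ (leq_trans sq sj)) subrr.
by rewrite eq subrr.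
Qed.

End HilbertBasis.

Lemma noetherian_field (k : fieldType) : noetherian k.
Proof.
move=> I hI; have [[x Ix x0]|h] := pselect (exists2 x, I x & x != 0).
  exists [:: 1]; apply/seteqP; split=> y _; first by apply/ideal_gen1; exists y; rewrite mulr1.
  have [_ _ hM] := hI.
  by rewrite -[y](divfK x0); apply: hM.
exists [::]; apply/seteqP; split=> y.
  move=> Iy; apply/ideal_gen_nil; apply: contrapT => /eqP y0; apply: h.
  by exists y.
by move=> /ideal_gen_nil->; case: hI.
Qed.

(** Variables are adjoined one at a time to a Noetherian ring mapping to S, whose image contains the
    constants and the first [l] variables. At [l = n] the map is onto, which is enough; no
    isomorphism with iterated polynomials is required. *)
Theorem noetherian_mpoly (k : fieldType) n : noetherian {mpoly k[n]}.
Proof.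
suff /(_ n (leqnn n))[T nT [f fC fX]] : forall l, (l <= n)%N ->
    exists2 T : comNzRingType, noetherian T &
    exists2 f : {rmorphism T -> {mpoly k[n]}}, (forall c, exists t, f t = c%:MP) &
      forall i : 'I_n, (i < l)%N -> exists t, f t = 'X_i.
  apply: (noetherian_surj (f := f)) nT => y; elim/mpolyind: y => [|c m p _ _ [t <-]].
    by exists 0; rewrite rmorph0.
  have [c' ec] := fC c.
  suff [x ex] : exists x, f x = 'X_[m].
    by exists (c' * x + t); rewrite rmorphD rmorphM ec ex mul_mpolyC.
  rewrite mpolyXE_id; elim/big_ind: _ => [|_ _ [x <-] [y <-]|i _].
  - by exists 1; rewrite rmorph1.
  - by exists (x * y); rewrite rmorphM.
  - by have [t' <-] := fX i (ltn_ord i); exists (t' ^+ m i); rewrite rmorphXn.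
elim=> [_|l IH ln].
  exists k; first exact: noetherian_field.
  by exists (@mpolyC n k) => // c; exists c.
have [T nT [f fC fX]] := IH (ltnW ln).
exists {poly T}; first exact: hilbert_basis.
pose x : {mpoly k[n]} := 'X_(Ordinal ln).
have cx : commr_rmorph f x by move=> y; exact: mulrC.
exists (horner_morph cx) => [c|i].
  by have [t <-] := fC c; exists t%:P; rewrite /= horner_morphC.
rewrite ltnS leq_eqVlt => /orP[/eqP il|/fX[t <-]].
  by exists 'X; rewrite /= horner_morphX; congr 'X_ _; apply: val_inj.
by exists t%:P; rewrite /= horner_morphC.
Qed.

(** * Quotients and residue fields *)

Section IdealQuotient.
Variables (R : comNzRingType) (I : set R) (I_ideal : is_ideal I) (I_proper : ~ I 1).

(** The two proofs are arguments so that the ideal structure can be inferred from the term alone.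
    [as_field] below follows the same pattern. *)
Definition proper_pred & is_ideal I & ~ I 1 : R -> bool := fun x => x \in I.

Local Notation J := (proper_pred I_ideal I_proper).

Let J_closed : idealr_closed J.
Proof. exact: (idealr_closedP I).2 (conj I_ideal I_proper). Qed.

HB.instance Definition _ := isIdealr.Build R J J_closed.

Lemma exists_idealr : exists J : idealr R, I = [set x | x \in J].
Proof. by exists J; apply/seteqP; split=> x /=; rewrite /in_mem /= inE. Qed.

End IdealQuotient.

Lemma ideal_quot_morphism (R : comNzRingType) (J : idealr R) :
  exists f : {rmorphism R -> {ideal_quot J}},
    (forall y, exists x, f x = y) /\ (forall x, f x = 0 <-> x \in J).
Proof.
exists (\pi_{ideal_quot J})%qT; split=> [y|x]; first by exists (repr y); exact: reprK.
rewrite -[x in x \in J]subr0 Quotient.idealrBE (rmorph0 (\pi_{ideal_quot J})%qT).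
by split=> [->|/eqP].
Qed.

Section ResidueField.
Variables (R : comNzRingType) (inv_ex : forall x : R, x != 0 -> exists y, y * x = 1).

Definition as_field of (forall x : R, x != 0 -> exists y, y * x = 1) : Type := R.
Local Notation K := (as_field inv_ex).

HB.instance Definition _ := GRing.ComNzRing.on K.

Let inv (x : K) : K := if x == 0 then 0 else xget 0 [set y | y * x = 1].

Let mulVf : forall x : K, x != 0 -> inv x * x = 1.
Proof.
move=> x x0; rewrite /inv (negPf x0).
exact: (xgetPex 0 (inv_ex x0)).
Qed.

Let inv0 : inv 0 = 0.
Proof. by rewrite /inv eqxx. Qed.

HB.instance Definition _ := GRing.ComNzRing_isField.Build K mulVf inv0.

Lemma exists_field : exists (F : fieldType) (f : {rmorphism R -> F}), bijective f.
Proof. by exists K, (@idfun K); exists id. Qed.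

End ResidueField.

Lemma residue_field (R : comNzRingType) (M : set R) : maximal_ideal M ->
  exists (K : fieldType) (f : {rmorphism R -> K}),
    (forall y, exists x, f x = y) /\ M = [set x | f x = 0].
Proof.
move=> /maximal_idealP[hM h1 hm]; have [J eJ] := exists_idealr hM h1.
have MJ x : M x <-> x \in J by rewrite eJ.
have [q [q_surj q_ker]] := ideal_quot_morphism J.
have [|F [f [g fK gK]]] := @exists_field {ideal_quot J}.
  move=> y; have [x <-] := q_surj y => x0.
  have /hm[a Ma] : ~ M x by move=> /MJ/q_ker/eqP; rewrite (negPf x0).
  exists (q a); rewrite -rmorphM -(rmorph1 q); apply/eqP.
  by rewrite -subr_eq0 -rmorphB; apply/eqP/q_ker/MJ.
exists F, (f \o q); split=> [y|].
  by have [x ex] := q_surj (g y); exists x; rewrite /= ex gK.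
apply/seteqP; split=> x /=; first by move=> /MJ/q_ker->; rewrite rmorph0.
by move=> fx; apply/MJ/q_ker; apply: (can_inj fK); rewrite fx rmorph0.
Qed.

(** * Zariski's lemma *)

(** With [a] the leading coefficient and m + 1 the degree, multiplying the equation of [b] by a^m
    makes it monic in [a b], with lower coefficients p_l a^(m - l). *)
Lemma integral_lead_coef (R K : comNzRingType) (f : {rmorphism R -> K}) (p : {poly R}) b :
  (1 < size p)%N -> root (map_poly f p) b -> integralOver f (f (lead_coef p) * b).
Proof.
move=> sp /eqP pb; set a := lead_coef p.
have [m em] : exists m, size p = m.+2 by exists (size p).-2; lia.
pose q := \poly_(l < m.+1) (p`_l * a ^+ (m - l)).
exists ('X^(m.+1) + q).
  rewrite monicE lead_coefDl ?lead_coefXn // size_polyXn.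
  by rewrite ltnS size_poly.
rewrite rootE rmorphD /= map_polyXn hornerD hornerXn.
have -> : (map_poly f q).[f a * b] = f a ^+ m * \sum_(l < m.+1) f p`_l * b ^+ l.
  rewrite (@horner_coef_wide _ m.+1); last first.
    by rewrite (leq_trans (size_poly _ _)) // size_poly.
  rewrite mulr_sumr; apply: eq_bigr => l _.
  rewrite coef_map coef_poly ltn_ord /= rmorphM rmorphXn exprMn.
  rewrite [RHS]mulrCA -mulrA; congr (_ * _).
  by rewrite mulrA -exprD subnK // -ltnS.
suff e : f a * b ^+ m.+1 + \sum_(l < m.+1) f p`_l * b ^+ l = 0.
  by rewrite exprMn exprSr -mulrA -mulrDr e mulr0.
rewrite -[RHS]pb (@horner_coef_wide _ m.+2).
  rewrite [RHS]big_ord_recr /= coef_map addrC; congr (_ + _); first by rewrite /a /lead_coef em.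
  by apply: eq_bigr => l _; rewrite coef_map.
by rewrite -em size_poly.
Qed.

(* Zariski's lemma for two generators.  If a were transcendental, K would be
   integral over k[a][1/c] with c the leading coefficient of a relation for b,
   and then 1 + a c would divide a power of c. *)
Lemma zariski2 (k K : fieldType) (f : {rmorphism k -> K}) (a b : K) :
  (forall z, exists F : {poly {poly k}},
     (map_poly (fun p => (map_poly f p).[a]) F).[b] = z) ->
  algebraicOver f a.
Proof.
move=> gen; apply: contrapT => nalg.
pose ev : {rmorphism {poly k} -> K} := horner_morph (fun y => mulrC a (f y)).
have gen' z : exists F : {poly {poly k}}, (map_poly ev F).[b] = z by exact: gen.
have ev_inj p : ev p = 0 -> p = 0.
  move=> pa; apply: contrapT => /eqP p0; apply: nalg.
  by exists p => //; apply/eqP.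
(* For [b] nonzero, its inverse is some G(b) with coefficients in k[a], and ['X * G - 1] has
   constant term -1. *)
have [F F0 /eqP Fb] : exists2 F : {poly {poly k}}, F != 0 & root (map_poly ev F) b.
  have [->|b0] := eqVneq b 0.
    by exists 'X; rewrite ?polyX_eq0 // map_polyX rootX.
  have [G eG] := gen' b^-1; exists ('X * G - 1).
    apply/eqP => /(congr1 (fun p : {poly {poly k}} => p`_0)).
    by rewrite coefB coefXM coef0 coef1 sub0r => /eqP; rewrite oppr_eq0 oner_eq0.
  by rewrite rootE rmorphB rmorphM rmorph1 /= map_polyX !hornerE eG divff ?subrr.
pose c := lead_coef F; have c0 : ev c != 0.
  by apply: contra_neq F0 => /ev_inj/eqP; rewrite lead_coef_eq0 => /eqP.
have sF : (1 < size F)%N.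
  rewrite ltnNge; apply/negP => /size1_polyC eF.
  move/eqP: c0; apply; rewrite -[RHS]Fb [X in map_poly ev X]eF map_polyC hornerC.
  by rewrite /c {1}eF lead_coefC.
have int_cb : integralOver ev (ev c * b) by apply: integral_lead_coef => //; apply/eqP.
have int_ev p : integralOver ev (ev p) by exact: integral_id.
(* [W] collects the elements that become integral over k[a] after multiplication by a power of [c];
   it is a subring containing k[a] and [b], hence everything. *)
pose W z := exists e, integralOver ev (ev c ^+ e * z).
have WD y z : W y -> W z -> W (y + z).
  move=> [d hd] [e he]; exists (d + e)%N; rewrite mulrDr exprD.
  by apply: integral_add; [rewrite mulrAC mulrC|rewrite -mulrA];
     apply: integral_mul => //; rewrite -rmorphXn.
have WM y z : W y -> W z -> W (y * z).
  by move=> [d hd] [e he]; exists (d + e)%N; rewrite exprD mulrACA; apply: integral_mul.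
have Wev p : W (ev p) by exists 0%N; rewrite mul1r.
have coef_ev (p : {poly {poly k}}) i : (map_poly ev p)`_i = ev p`_i.
  exact: coef_map.
have W_all z : W z.
  have [G <-] := gen' z; rewrite horner_coef; elim/big_ind: _ => [|y y'|i _].
  - by rewrite -(rmorph0 ev).
  - exact: WD.
  - rewrite coef_ev; apply: (WM); first exact: Wev.
    elim: (i : nat) => [|m IH].
      by rewrite expr0 -(rmorph1 ev).
    by rewrite exprS; apply: (WM) => //; exists 1%N; rewrite expr1.
(* The factor ['X] keeps [d] nonconstant even when [c] is constant, and [d] is coprime to [c]. *)
pose d := 1 + 'X * c.
have c_neq0 : c != 0 by rewrite lead_coef_eq0.
have sXc : (1 < size ('X * c)%R)%N by rewrite mulrC size_mulX // ltnS size_poly_gt0.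
have sd : (1 < size d)%N by rewrite /d addrC size_polyDl // size_poly1.
have d0 : ev d != 0 by apply/eqP => /ev_inj d0; rewrite d0 size_poly0 in sd.
have [e [q qm /eqP qd]] := W_all (ev d)^-1.
(* Clear denominators in the monic equation of [c ^+ e / d]: all terms but the leading one are
   multiples of [d]. *)
have dvd : d %| c ^+ (e * (size q).-1).
  have sq : size q = (size q).-1.+1 by rewrite -polySpred // monic_neq0.
  set m := (size q).-1 in sq *.
  suff : ev (c ^+ (e * m) + d * \sum_(i < m) q`_i * c ^+ (e * i) * d ^+ (m.-1 - i)) = 0.
    move/ev_inj/eqP; rewrite addr_eq0 => /eqP->.
    by rewrite dvdpNr dvdp_mulr.
  have : ev d ^+ m * (map_poly ev q).[ev c ^+ e / ev d] = 0 by rewrite qd mulr0.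
  rewrite (@horner_coef_wide _ m.+1); last by rewrite -sq size_poly.
  rewrite big_ord_recr /= mulrDr addrC.
  have -> : (map_poly ev q)`_m = 1.
    by rewrite coef_ev /m -lead_coefE (monicP qm) rmorph1.
  rewrite mul1r exprMn exprVn mulrCA divff ?expf_neq0 // mulr1 -exprM => em.
  rewrite rmorphD rmorphXn rmorphM rmorph_sum -[RHS]em !mulr_sumr; congr (_ + _).
  apply: eq_bigr => i _; rewrite coef_ev !rmorphM !rmorphXn exprMn exprVn -exprM.
  have -> : ev d ^+ m = ev d * ev d ^+ (m.-1 - i) * ev d ^+ i.
    by rewrite -exprS -exprD; congr (_ ^+ _); have := ltn_ord i; lia.
  move: (expf_neq0 i d0); move: (ev d ^+ i) (ev d ^+ (m.-1 - i)) => D E D0.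
  by field.
have cop : coprimep d c.
  by rewrite /d coprimep_sym addrC coprimep_addl_mul coprimep1.
have := coprimep_expr (e * (size q).-1) cop.
move/coprimep_dvdl: dvd => /[apply]; rewrite coprimepp => /eqP h.
by rewrite h in sd.
Qed.

(** * Monomial ideals *)

Section Monomials.
Variable n : nat.
Implicit Types (a b c m : 'X_{1..n}) (T : pred 'I_n) (A : 'X_{1..n} -> Prop).

(** When [T] consists of the two ends of an edge, this is the order of x^a along the edge prime: x^a
    lies in the d-th power of that prime exactly when the weight is at least d. *)
Definition weight_off T a : nat := \sum_(t | ~~ T t) a t.

Lemma weight_offD T a b : weight_off T (a + b)%MM = (weight_off T a + weight_off T b)%N.
Proof. by rewrite -big_split; apply: eq_bigr => t _; rewrite mnmDE. Qed.

Lemma weight_off0 T : weight_off T 0%MM = 0%N.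
Proof. by rewrite /weight_off big1 // => t _; rewrite mnm0E. Qed.

Lemma weight_offU T t : weight_off T U_(t)%MM = ~~ T t.
Proof.
rewrite /weight_off; case: (boolP (T t)) => Tt.
  by rewrite big1 // => s; rewrite mnm1E; case: eqP => // <-; rewrite Tt.
rewrite (bigD1 t) //= mnm1E eqxx big1 // => s /andP[_]; rewrite mnm1E eq_sym.
by move=> /negPf->.
Qed.

Lemma leq_weight_off T t a : ~~ T t -> (a t <= weight_off T a)%N.
Proof. by move=> Tt; rewrite /weight_off (bigD1 t) //= leq_addr. Qed.

Lemma weight_off_gt0 T a : (0 < weight_off T a)%N -> exists2 t, ~~ T t & (0 < a t)%N.
Proof.
rewrite lt0n sum_nat_eq0 negb_forall => /existsP[t]; rewrite negb_imply -lt0n => /andP[].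
by exists t.
Qed.

Lemma mnm_addU t a : (0 < a t)%N -> exists b, a = (U_(t) + b)%MM.
Proof.
by move=> at0; exists (a - U_(t))%MM; rewrite addmC submK // lep1mP -lt0n.
Qed.

Variable k : fieldType.
Implicit Types (f g : {mpoly k[n]}) (I : set {mpoly k[n]}).

Definition monomial_span A : set {mpoly k[n]} := [set f | forall a, f@_a != 0 -> A a].

Lemma monomial_spanX A a : monomial_span A 'X_[a] <-> A a.
Proof.
split=> [|Aa b]; first by apply; rewrite mcoeffX eqxx oner_eq0.
by rewrite mcoeffX; case: (a =P b) => [<-//|]; rewrite eqxx.
Qed.

Lemma mcoeffM_neq0 f g a : (f * g)@_a != 0 ->
  exists b c, [/\ a = (b + c)%MM, f@_b != 0 & g@_c != 0].
Proof.
rewrite -mcoeff_msupp => /msuppM_le/allpairsP[[b c] /= []].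
by rewrite !mcoeff_msupp => *; exists b, c.
Qed.

Lemma monomial_span_ideal A : (forall a b, A a -> A (b + a)%MM) -> is_ideal (monomial_span A).
Proof.
move=> hA; split=> [a|f g hf hg a|f g hg a]; first by rewrite mcoeff0 eqxx.
  rewrite mcoeffD; have [->|/hf//] := eqVneq f@_a 0.
  by rewrite add0r => /hg.
by move=> /mcoeffM_neq0[b [c [-> _ /hg]]]; exact: hA.
Qed.

Lemma monomial_span_sub A I : is_ideal I -> (forall a, A a -> I 'X_[a]) ->
  monomial_span A `<=` I.
Proof.
move=> hI AI f hf; rewrite [f]mpolyE big_seq; apply: ideal_sum => // a.
rewrite mcoeff_msupp -mul_mpolyC => /hf/AI; case: hI => _ _; apply.
Qed.

Lemma edge_primeE i j :
  edge_prime k i j = monomial_span (fun a => (0 < weight_off (pred2 i j) a)%N).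
Proof.
apply/seteqP; split.
  apply: ideal_gen_min.
    by apply: monomial_span_ideal => a b; rewrite weight_offD addn_gt0 orbC => ->.
  move=> _ [t /= ht <-]; apply/monomial_spanX.
  by rewrite weight_offU /= negb_or ht.
apply: monomial_span_sub; first exact: ideal_gen_ideal.
move=> a /weight_off_gt0[t ht /mnm_addU[b ->]].
rewrite mpolyXD; apply: (ideal_mulr _ (ideal_gen_ideal _)).
by apply: sub_ideal_gen; exists t => //=; rewrite -negb_or.
Qed.

Variable G : rel 'I_n.

(** I is the Stanley-Reisner ideal of [G] seen as a one-dimensional complex, whence the name. *)
Definition nonface a : Prop := forall i j, G i j -> (0 < weight_off (pred2 i j) a)%N.

Definition nonface2 a : Prop := exists b c, [/\ nonface b, nonface c & a = (b + c)%MM].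

Lemma nonfaceD a b : nonface a -> nonface (b + a)%MM.
Proof. by move=> ha i j /ha h; rewrite weight_offD addn_gt0 h orbT. Qed.

Lemma nonface2D a b : nonface2 a -> nonface2 (b + a)%MM.
Proof.
move=> [c [d [hc hd ->]]]; exists (b + c)%MM, d; rewrite addmA; split=> //.
exact: nonfaceD.
Qed.

Lemma nonface_pair i j : i != j -> ~~ G i j -> ~~ G j i -> nonface (U_(i) + U_(j))%MM.
Proof.
move=> ij nij nji s t st; rewrite weight_offD !weight_offU /= lt0n.
apply/negP; rewrite addn_eq0 !eqb0 !negbK => /andP[].
case/orP=> /eqP ei; case/orP=> /eqP ej; subst.
- by rewrite eqxx in ij.
- by rewrite st in nij.
- by rewrite st in nji.
- by rewrite eqxx in ij.
Qed.

Lemma nonface2_pairs i j s t a :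
  i != j -> ~~ G i j -> ~~ G j i -> s != t -> ~~ G s t -> ~~ G t s ->
  (U_(i) + U_(j) + (U_(s) + U_(t)) <= a)%MM -> nonface2 a.
Proof.
move=> *; rewrite -[a](submK (m := U_(i) + U_(j) + (U_(s) + U_(t)))) //.
apply: nonface2D; exists (U_(i) + U_(j))%MM, (U_(s) + U_(t))%MM.
by split=> //; apply: nonface_pair.
Qed.

Lemma graph_idealE : graph_ideal G k = monomial_span nonface.
Proof.
apply/seteqP; split=> f hf.
  move=> a fa i j Gij; have /= := hf (i, j) Gij; rewrite edge_primeE; exact.
by move=> [i j] /= Gij; rewrite edge_primeE => a /hf; apply.
Qed.

Lemma graph_ideal_sqrE : ideal_pow (graph_ideal G k) 2 = monomial_span nonface2.
Proof.
apply/seteqP; split.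
  apply: ideal_gen_min; first by apply: monomial_span_ideal => a b; apply: nonface2D.
  move=> _ [f If ->]; rewrite big_ord_recr big_ord1 /=.
  move=> a /mcoeffM_neq0[b [c [-> fb fc]]]; exists b, c.
  have hf i : monomial_span nonface (f i) by rewrite -graph_idealE; exact: If.
  by split=> //; [exact: hf fb|exact: hf fc].
apply: monomial_span_sub; first exact: ideal_gen_ideal.
move=> _ [b [c [hb hc ->]]]; apply: sub_ideal_gen.
exists (fun i => if val i == 0%N then 'X_[b] else 'X_[c]).
  by move=> i; rewrite graph_idealE; case: ifP => _; apply/monomial_spanX.
by rewrite big_ord_recr big_ord1 /= mpolyXD.
Qed.

End Monomials.

(** * Consequences of depth 2 *)

Lemma ideal_exprD (R : comNzRingType) (I : set R) (x y : R) d e : is_ideal I ->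
  I (x ^+ d) -> I (y ^+ e) -> I ((x + y) ^+ (d + e)).
Proof.
move=> hI Ix Iy; rewrite exprDn; apply: ideal_sum => // i _.
have [_ _ hM] := hI; rewrite -mulr_natr mulrC; apply: (hM).
have [de|de] := leqP e i.
  by rewrite -[X in y ^+ X](subnK de) exprD mulrA; apply: hM.
rewrite (_ : d + e - i = d + (e - i))%N; last by move: de; clear; lia.
by rewrite exprD -mulrA; apply: ideal_mulr.
Qed.

Section Depth2.
Variables (k : fieldType) (n : nat).
Implicit Types (f g u : {mpoly k[n]}) (a b m : 'X_{1..n}).

(** The polynomials having a power in the ideal of the [X_i ^+ N] are closed under sums, and a
    nonconstant term, being divisible by some [X_i], is one of them. *)
Lemma expr_sum_powers f N : f@_0%MM = 0 ->
  exists M c, f ^+ M = \sum_(i < n) c i * 'X_i ^+ N.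
Proof.
move=> f0; pose L := [set h : {mpoly k[n]} | exists c, h = \sum_(i < n) c i * 'X_i ^+ N].
have hL : is_ideal L.
  split=> [|_ _ [c ->] [d ->]|a _ [c ->]].
  - by exists (fun=> 0); rewrite big1 // => i _; rewrite mul0r.
  - exists (fun i => c i + d i); rewrite -big_split.
    by apply: eq_bigr => i _; rewrite mulrDl.
  - exists (fun i => a * c i); rewrite mulr_sumr.
    by apply: eq_bigr => i _; rewrite mulrA.
suff [M [c e]] : exists M, L (f ^+ M) by exists M, c.
rewrite [f]mpolyE big_seq; elim/big_ind: _ => [|x y [d hd] [e he]|a].
- by exists 1%N; rewrite expr1; case: hL.
- by exists (d + e)%N; apply: ideal_exprD.
rewrite mcoeff_msupp => fa.
have [i ai] : exists i, (0 < a i)%N.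
  apply: contrapT => h; move: fa; suff -> : a = 0%MM by rewrite f0 eqxx.
  apply/mnmP => i; rewrite mnm0E; apply/eqP; rewrite -leqn0 leqNgt.
  by apply/negP => ai; apply: h; exists i.
have [b eb] := mnm_addU ai; exists N.
rewrite {2}eb mpolyXD -mul_mpolyC mulrCA exprMn.
exists (fun j => if j == i then ((f@_a)%:MP * 'X_[b]) ^+ N else 0).
rewrite (bigD1 i) //= eqxx big1 ?addr0 1?mulrC // => j /negPf->.
by rewrite mul0r.
Qed.

Lemma mcoeffXnM_lt i N u m : (m i < N)%N -> ('X_i ^+ N * u)@_m = 0.
Proof.
move=> mN; apply/eqP; apply: contraTT mN => /mcoeffM_neq0[b [c [-> hb _]]].
rewrite -leqNgt mnmDE; move: hb; rewrite mcoeffXn.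
case: (_ =P b) => [<-|]; last by rewrite eqxx.
by rewrite mulmnE mnm1E eqxx mul1n leq_addr.
Qed.

Lemma mcoeffXnM i N u m : ('X_i ^+ N * u)@_(U_(i) *+ N + m) = u@_m.
Proof. by rewrite mpolyXn mulrC mcoeffMX. Qed.

Variable G : rel 'I_n.
Local Notation K := (monomial_span (k := k) (nonface2 G)).

Lemma nonface_triple i j s : i != j -> i != s -> j != s ->
  nonface G (U_(i) + U_(j) + U_(s))%MM.
Proof.
move=> ij i_s js x y _; rewrite !weight_offD !weight_offU /=.
have disj z : ((i == z) + (j == z) + (s == z) <= 1)%N.
  have [<-|_] := eqVneq i z; first by rewrite !(eq_sym _ i) (negPf ij) (negPf i_s).
  by have [<-|_] := eqVneq j z; rewrite ?(eq_sym _ j) ?(negPf js) //; case: eqP.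
by move: (disj x) (disj y); do 6!case: (_ == _).
Qed.

(** In Cech terms, [b i] stands for the section b_i / X_i^N where X_i is invertible: compatible
    sections over the punctured spectrum of S/I^2 extend over the origin. *)
Definition glueing : Prop := forall N (b : 'I_n -> {mpoly k[n]}),
  (forall i j, K ('X_j ^+ N * b i - 'X_i ^+ N * b j)) ->
  exists u, forall i, K ('X_i ^+ N * u - b i).

Lemma depth2_glueing (R : comNzRingType) (p : {rmorphism {mpoly k[n]} -> R}) :
  (forall y, exists x, p x = y) -> (forall x, p x = 0 <-> K x) ->
  forall f g s, f@_0%MM = 0 -> g@_0%MM = 0 -> regular_sequence [:: p f, p g & s] ->
  glueing.
Proof.
move=> psurj pK f g s f0 g0 /regular_sequence2[hf hg] N b hb.
have [M [c ec]] := expr_sum_powers N f0.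
have [M' [d ed]] := expr_sum_powers N g0.
have [hf' hg'] := regular_pow M M' hf hg.
have [||i j|u hu] := @regular_glue _ _ _ 'I_n (fun i => p 'X_i ^+ N)
    (fun i => p (b i)) (fun i => p (c i)) (fun i => p (d i)) hf' hg'.
- rewrite -rmorphXn ec rmorph_sum; apply: eq_bigr => i _.
  by rewrite rmorphM rmorphXn.
- rewrite -rmorphXn ed rmorph_sum; apply: eq_bigr => i _.
  by rewrite rmorphM rmorphXn.
- apply/eqP; rewrite -subr_eq0 -!rmorphXn -!rmorphM -rmorphB; apply/eqP/pK.
  exact: hb.
have [v ev] := psurj u; exists v => i; apply/pK.
by rewrite rmorphB rmorphM rmorphXn ev hu subrr.
Qed.

Hypothesis G_glue : glueing.

(* The section X_s X_t X_r / X_i over X_i <> 0, and 0 elsewhere, does not extend. *)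
Lemma glueing_degree i s t r : G i s -> G i t -> G i r ->
  i != s -> i != t -> i != r -> s != t -> s != r -> t != r -> False.
Proof.
move=> Gs Gt Gr i_s it ir st sr tr.
(* x^m / X_i^3 is the section X_s X_t X_r / X_i written with the denominator X_i^3. *)
pose m := (U_(i) *+ 2 + U_(s) + U_(t) + U_(r))%MM.
have mE x : m x = ((i == x) * 2 + (s == x) + (t == x) + (r == x))%N.
  by rewrite !mnmDE ?mulmnE !mnm1E; lia.
have K0 : K 0 by move=> a; rewrite mcoeff0 eqxx.
have Km j : j != i -> K ('X_j ^+ 3 * 'X_[m]).
  move=> ji; rewrite mpolyXn -mpolyXD; apply/monomial_spanX.
  (* Two of the three neighbours, x and y, differ from j, and X_j^3 x^m is divisible by (X_i X_j
     X_x)(X_i X_j X_y). So the section vanishes on the overlaps. *)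
  have use x y : i != x -> i != y -> j != x -> j != y -> x != y ->
      (x \in [:: s; t; r]) -> (y \in [:: s; t; r]) -> nonface2 G (U_(j) *+ 3 + m)%MM.
    move=> ix iy jx jy xy xin yin.
    have le : (U_(i) + U_(j) + U_(x) + (U_(i) + U_(j) + U_(y)) <= U_(j) *+ 3 + m)%MM.
      apply/mnm_lepP => z; rewrite [leqRHS]mnmDE mE !mnmDE ?mulmnE !mnm1E.
      move: xin yin xy; rewrite !inE => /or3P[]/eqP-> /or3P[]/eqP->;
        rewrite ?eqxx //; move: ji; case: (j =P z) (i =P z) => [->|_] [->|_]; rewrite ?eqxx;
        clear; lia.
    rewrite -(submK le); apply: nonface2D.
    exists (U_(i) + U_(j) + U_(x))%MM, (U_(i) + U_(j) + U_(y))%MM.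
    by split=> //; apply: nonface_triple; rewrite // eq_sym.
  have [js|js] := eqVneq j s.
    by apply: (use t r); rewrite ?inE ?eqxx ?orbT ?js.
  have [jt|jt] := eqVneq j t.
    by apply: (use s r); rewrite ?inE ?eqxx ?orbT ?jt // eq_sym.
  by apply: (use s t); rewrite ?inE ?eqxx ?orbT.
have [|u /(_ i)/(_ m)] := @G_glue 3 (fun j => if j == i then 'X_[m] else 0).
  move=> x y; have [->|xi] := eqVneq x i; have [->|yi] := eqVneq y i.
  - by rewrite subrr.
  - by rewrite mulr0 subr0; apply: Km.
  - by rewrite mulr0 sub0r; apply: idealN (Km _ xi); apply/monomial_span_ideal/nonface2D.
  - by rewrite !mulr0 subrr.
(* X_i has exponent 2 in [m], so X_i^3 u has no term x^m; an extension would force x^m into I^2. *)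
rewrite eqxx mcoeffB mcoeffXnM_lt; last first.
  by rewrite mE eqxx -!(eq_sym i) (negPf i_s) (negPf it) (negPf ir).
rewrite mcoeffX eqxx sub0r oppr_eq0 oner_eq0 => /(_ isT)[b [c [hb hc em]]].
have bc x : m x = (b x + c x)%N by rewrite em mnmDE.
have one x : (x \in [:: s; t; r]) -> (b x + c x = 1)%N.
  rewrite -bc mE !inE => /or3P[]/eqP->; rewrite eqxx.
  - by rewrite (negPf i_s) -!(eq_sym s) (negPf st) (negPf sr).
  - by rewrite (negPf it) (negPf st) -(eq_sym t) (negPf tr).
  - by rewrite (negPf ir) (negPf sr) (negPf tr).
have supp x : m x != 0%N -> [|| x == i, x == s, x == t | x == r].
  by rewrite mE -!(eq_sym x); do 4!case: (x == _).
(* A factor [d] must leave the edge from [i] to [z], hence involve [x] or [y]. Over the three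
   choices of [z], each of [b] and [c] needs two of X_s, X_t, X_r, but [m] contains each of these
   only once. *)
have two d x y z : nonface G d -> (forall v, d v <= m v)%N ->
    G i z -> [:: x; y; z] =i [:: s; t; r] -> (0 < d x + d y)%N.
  move=> hd dm /hd/weight_off_gt0[v /= vz dv] xyz.
  have /supp : m v != 0%N by rewrite -lt0n (leq_trans dv).
  move: vz; rewrite negb_or => /andP[/negPf-> vz] /=.
  have := xyz v; rewrite !inE (negPf vz) orbF => <- /orP[]/eqP<-.
    by rewrite addn_gt0 dv.
  by rewrite addn_gt0 dv orbT.
have bm v : (b v <= m v)%N by rewrite bc leq_addr.
have cm v : (c v <= m v)%N by rewrite bc leq_addl.
have := one s; have := one t; have := one r; rewrite !inE !eqxx !orbT.
have e1 : [:: s; r; t] =i [:: s; t; r].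
  by move=> v; rewrite !inE; do 3!case: (v == _).
have e2 : [:: t; r; s] =i [:: s; t; r] by move=> v; rewrite !inE orbA orbC.
have := two b s t r hb bm Gr (fun _ => erefl); have := two c s t r hc cm Gr (fun _ => erefl).
have := two b s r t hb bm Gt e1; have := two c s r t hc cm Gt e1.
have := two b t r s hb bm Gs e2; have := two c t r s hc cm Gs e2.
clear; lia.
Qed.

Hypothesis G_simple : simple_graph G.

(** For a neighbour [t] of [i], each factor must leave the edge from [i] to [t] and thus involve
    X_j, which occurs only once. *)
Lemma not_nonface2_star i j : i != j -> ~~ G i j ->
  ~ nonface2 G (U_(i) *+ 3 + U_(j))%MM.
Proof.
move=> ij nij [b [c [hb hc em]]]; have [Gsym Girr /(_ i)[t Git]] := G_simple.
have jt : j != t by apply: contraNneq nij => ->.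
have pos d e : nonface G d -> (U_(i) *+ 3 + U_(j))%MM = (d + e)%MM -> (0 < d j)%N.
  move=> /(_ i t Git)/weight_off_gt0[x /=]; rewrite negb_or => /andP[xi xt] dx.
  move=> /mnmP/(_ x); rewrite !mnmDE ?mulmnE !mnm1E (eq_sym i) (negPf xi).
  by case: (j =P x) => [->//|_]; move: dx; clear; lia.
have := pos b c hb em; have := pos c b hc (etrans em (addmC b c)).
move/mnmP/(_ j): em; rewrite !mnmDE ?mulmnE !mnm1E (negPf ij) eqxx; clear; lia.
Qed.

(* Otherwise the section equal to X_i X_j over the union of the X_t <> 0, for t in
   the closed neighbourhood of i, and to 0 elsewhere does not extend. *)
Lemma glueing_common_neighbour i j : i != j -> ~~ G i j -> exists t, G i t && G t j.
Proof.
move=> ij nij; apply: contrapT => hno; have [Gsym Girr _] := G_simple.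
have no t : G i t -> ~~ G t j by move=> it; apply/negP => tj; apply: hno; exists t; rewrite it.
pose N t := (t == i) || G i t; pose m t := (U_(t) *+ 2 + U_(i) + U_(j))%MM.
have Nj : ~~ N j by rewrite /N negb_or eq_sym ij.
have K0 : K 0 by move=> a; rewrite mcoeff0 eqxx.
(* X_s^2 X_t^2 X_i X_j is divisible by (X_s X_t)^2 if s and t are not adjacent. Otherwise t is a
   neighbour of i, and the product is divisible by (X_s X_i)(X_t X_j), as s is not adjacent to i and
   t not to j. *)
have Km s t : N t -> ~~ N s -> K ('X_s ^+ 2 * 'X_[m t]).
  move=> Nt Ns; rewrite mpolyXn -mpolyXD; apply/monomial_spanX.
  have st : s != t by apply: contraNneq Ns => ->.
  move: (Ns); rewrite negb_or => /andP[si nis].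
  have [Gst|nst] := boolP (G s t); last first.
    apply: (@nonface2_pairs _ _ s t s t); rewrite // 1?Gsym //.
    by apply/mnm_lepP => x; rewrite !mnmDE ?mulmnE !mnm1E; clear; lia.
  have Git : G i t by move: Nt; rewrite /N => /orP[/eqP eti|//]; rewrite -eti Gsym Gst in nis.
  have tj : t != j by apply: contraNneq nij => <-.
  have ntj := no t Git.
  apply: (@nonface2_pairs _ _ s i t j) => //; first by rewrite Gsym.
    by rewrite Gsym.
  by apply/mnm_lepP => x; rewrite !mnmDE ?mulmnE !mnm1E; clear; lia.
have [|u hu] := @G_glue 2 (fun t => if N t then 'X_[m t] else 0).
  have hK : is_ideal K by apply/monomial_span_ideal/nonface2D.
  move=> x y; have [Nx|nx] := boolP (N x); have [Ny|ny] := boolP (N y).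
  - rewrite !mpolyXn -!mpolyXD (_ : (_ + m x)%MM = (U_(x) *+ 2 + m y)%MM) ?subrr //.
    by apply/mnmP => z; rewrite !mnmDE; clear; lia.
  - by rewrite mulr0 subr0; apply: Km.
  - by rewrite mulr0 sub0r; apply: (idealN hK); apply: Km.
  - by rewrite !mulr0 subrr.
have star (x y : 'I_n) : (U_(x) *+ 3 + U_(y))%MM = (U_(x) *+ 2 + (U_(x) + U_(y)))%MM.
  by apply/mnmP => z; rewrite !mnmDE ?mulmnE !mnm1E; clear; lia.
(* Neither X_i^3 X_j nor X_j^3 X_i lies in I^2. Hence [u] has coefficient 1 at X_i X_j by its
   behaviour at X_i, and coefficient 0 by that at X_j. *)
have ui : u@_(U_(i) + U_(j)) = 1.
  apply/eqP; rewrite -subr_eq0; apply: contra_notT (not_nonface2_star ij nij) => h.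
  apply: (hu i); rewrite star /N eqxx mcoeffB mcoeffXnM mcoeffX.
  rewrite (_ : m i == _); first exact: h.
  by apply/eqP/mnmP => z; rewrite !mnmDE; clear; lia.
apply: (@not_nonface2_star j i); rewrite ?(eq_sym j) // 1?Gsym //.
apply: (hu j); rewrite (negPf Nj) subr0 star mcoeffXnM addmC ui oner_eq0 //.
Qed.

End Depth2.

(** * Cycles *)

Section Cycles.
Variables (n : nat) (G : rel 'I_n).
Hypothesis G_simple : simple_graph G.

Lemma fresh_vertex (l : seq 'I_n) : (size l < n)%N -> exists x, x \notin l.
Proof.
move=> ln; apply: contrapT => h; move: ln; rewrite ltnNge => /negP; apply.
rewrite -[X in (X <= _)%N]card_ord; apply: leq_trans (card_size l).
apply: subset_leq_card; apply/fintype.subsetP => x _; apply/negP => /negP xl.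
by apply: h; exists x.
Qed.

Lemma cycle4P a b c d : uniq [:: a; b; c; d] -> (forall w, w \in [:: a; b; c; d]) ->
  G a =1 pred2 b d -> G b =1 pred2 a c -> G c =1 pred2 b d -> G d =1 pred2 a c ->
  is_cycle G 4.
Proof.
move=> U cover Na Nb Nc Nd; split=> //; exists [:: a; b; c; d]; split=> // i j.
rewrite !cover; move: (cover i) (cover j) U; rewrite /= !inE !negb_or andbT.
move=> ci cj /and3P[/and3P[ab ac ad] /andP[bc bd] cd].
have [ba ca da] := And3 (eq_sym b a) (eq_sym c a) (eq_sym d a).
have [cb db dc] := And3 (eq_sym c b) (eq_sym d b) (eq_sym d c).
have neqs := (negPf ab, negPf ac, negPf ad, negPf bc, negPf bd, negPf cd, eqxx).
case/or4P: ci => /eqP->; case/or4P: cj => /eqP->; rewrite ?Na ?Nb ?Nc ?Nd /=;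
  by do 4?rewrite ?ba ?ca ?da ?cb ?db ?dc ?neqs /=.
Qed.

Lemma cycle5P a b c d e : uniq [:: a; b; c; d; e] ->
  (forall w, w \in [:: a; b; c; d; e]) ->
  G a =1 pred2 b e -> G b =1 pred2 a c -> G c =1 pred2 b d -> G d =1 pred2 c e ->
  G e =1 pred2 a d -> is_cycle G 5.
Proof.
move=> U cover Na Nb Nc Nd Ne; split=> //; exists [:: a; b; c; d; e]; split=> // i j.
rewrite !cover; move: (cover i) (cover j) U; rewrite /= !inE !negb_or andbT.
move=> ci cj /and4P[/and4P[ab ac ad ae] /and3P[bc bd be] /andP[cd ce] de].
have [[ba ca da] ea] := (And3 (eq_sym b a) (eq_sym c a) (eq_sym d a), eq_sym e a).
have [cb db eb] := And3 (eq_sym c b) (eq_sym d b) (eq_sym e b).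
have [dc ec ed] := And3 (eq_sym d c) (eq_sym e c) (eq_sym e d).
have neqs := (negPf ab, negPf ac, negPf ad, negPf ae, negPf bc, negPf bd, negPf be,
  negPf cd, negPf ce, negPf de, eqxx).
case/orP: ci => [/eqP->|/or4P[]/eqP->]; case/orP: cj => [/eqP->|/or4P[]/eqP->];
  rewrite ?Na ?Nb ?Nc ?Nd ?Ne /=;
  by do 5?rewrite ?ba ?ca ?da ?ea ?cb ?db ?eb ?dc ?ec ?ed ?neqs /=.
Qed.

(** Every vertex has exactly two neighbours. A vertex, its two neighbours and their further
    neighbours exhaust the graph, and the two further neighbours either coincide, giving a square,
    or are adjacent, giving a pentagon. *)
Lemma is_cycle_4_5 : (4 <= n)%N ->
  (forall i s t r, G i s -> G i t -> G i r -> s != t -> s != r -> t != r -> False) ->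
  (forall i j, i != j -> ~~ G i j -> exists t, G i t && G t j) ->
  is_cycle G 4 \/ is_cycle G 5.
Proof.
move=> n4 deg diam; have [Gsym Girr Gnb] := G_simple.
have Gne i j : G i j -> i != j by move=> h; apply: contraTneq h => ->; rewrite Girr.
have nbE i s t : G i s -> G i t -> s != t -> G i =1 pred2 s t.
  move=> is_ it st r /=; apply/idP/orP => [ir|[]/eqP->//].
  have [|/= rs] := eqVneq r s; first by left.
  have [|/= rt] := eqVneq r t; first by right.
  by case: (deg i s t r); rewrite // eq_sym.
(* If [s] were the only neighbour of [i], every other vertex would reach [i] through [s], and with
   four vertices [s] would have three neighbours. *)
have two i s : G i s -> exists2 t, t != s & G i t.
  move=> is_; apply: contrapT => h.
  have only t : G i t -> t = s.
    by move=> it; apply/eqP/negPn/negP => ts; apply: h; exists t.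
  have far p : p \notin [:: i; s] -> G s p.
    rewrite !inE negb_or => /andP[pi_ ps].
    have [||t /andP[/only-> //]] := diam i p; first by rewrite eq_sym.
    by apply/negP => /only ep; rewrite ep eqxx in ps.
  have [p pl] := @fresh_vertex [:: i; s] (ltn_trans (isT : 2 < 3)%N n4).
  have [q ql] := @fresh_vertex [:: p; i; s] n4.
  move: ql; rewrite inE negb_or => /andP[qp ql].
  apply: (deg s i p q _ (far p pl) (far q ql)); rewrite 1?Gsym 1?eq_sym //.
  - by move: pl; rewrite !inE negb_or => /andP[].
  - by move: ql; rewrite !inE negb_or => /andP[].
have n0 : (0 < n)%N by apply: leq_trans n4.
pose v0 := Ordinal n0; have [v1 G01] := Gnb v0.
have [v4 n41 G04] := two _ _ G01.
have [v2 n20 G12] : exists2 t, t != v0 & G v1 t by apply: two; rewrite Gsym.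
have [v3 n30 G43] : exists2 t, t != v0 & G v4 t by apply: two; rewrite Gsym.
have N0 := nbE _ _ _ G01 G04 (introN eqP (fun e => elimN eqP n41 (esym e))).
have N1 : G v1 =1 pred2 v0 v2 by apply: nbE; rewrite // 1?Gsym // eq_sym.
have N4 : G v4 =1 pred2 v0 v3 by apply: nbE; rewrite // 1?Gsym // eq_sym.
have cover w : w \in [:: v0; v1; v2; v3; v4].
  rewrite !inE; have [//|/= w0] := eqVneq w v0.
  have [|nw] := boolP (G v0 w); first by rewrite N0 => /orP[]->; rewrite ?orbT.
  have [|t] := diam v0 w _ nw; first by rewrite eq_sym.
  rewrite N0 => /andP[/orP[]/eqP->]; rewrite ?N1 ?N4 /= (negPf w0) /= => ->; rewrite ?orbT //.
have [n10 n40] : v1 != v0 /\ v4 != v0 by split; rewrite eq_sym Gne.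
have n21 : v2 != v1 by rewrite eq_sym Gne.
have n34 : v3 != v4 by rewrite eq_sym Gne.
(* Equality would make v0, v1, v4 a triangle with v3 = v1, and [cover] would leave only three
   vertices. *)
have n24 : v2 != v4.
  apply/eqP => e24; have : G v4 v1 by rewrite Gsym -e24.
  rewrite N4 /= (negPf n10) => /eqP e13.
  have [x] := @fresh_vertex [:: v0; v1; v4] n4.
  by move: (cover x); rewrite e24 -e13 !inE; do 3!case: (x == _).
have n31 : v3 != v1.
  apply/eqP => e31; have : G v1 v4 by rewrite Gsym -e31.
  by rewrite N1 /= (negPf n40) eq_sym (negPf n24).
have [e23|n23] := eqVneq v2 v3.
  subst v3; have N2 : G v2 =1 pred2 v1 v4 by apply: nbE; rewrite 1?Gsym // eq_sym.
  left; apply: (@cycle4P v0 v1 v2 v4) => //.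
  - rewrite /= !inE !negb_or !(eq_sym v0) n10 n20 n40 /= !(eq_sym v1) n21 n41 /=.
    by rewrite n24.
  - by move=> w; move: (cover w); rewrite !inE; do 4!case: (w == _).
have [t t1 G2t] : exists2 t, t != v1 & G v2 t by apply: two; rewrite Gsym.
have et : t = v3.
  have n2t := Gne _ _ G2t.
  have : G t v2 by rewrite Gsym.
  move: (cover t); rewrite !inE (negPf t1) (eq_sym t v2) (negPf n2t) /=.
  case/or3P=> /eqP->; rewrite ?N0 ?N4 //= ?(negPf n21) ?(negPf n24) ?(negPf n20) //=.
  by move=> /eqP e23; rewrite e23 eqxx in n23.
subst t; have N2 : G v2 =1 pred2 v1 v3 by apply: nbE; rewrite // 1?Gsym // eq_sym.
have N3 : G v3 =1 pred2 v2 v4 by apply: nbE; rewrite 1?Gsym.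
right; apply: (@cycle5P v0 v1 v2 v3 v4) => //.
rewrite /= !inE !negb_or !(eq_sym v0) n10 n20 n30 n40 /= !(eq_sym v1) n21 n31 n41 /=.
by rewrite n23 n24 n34.
Qed.

End Cycles.

(** * Properties of the cycles of length 4 and 5 *)

Section CycleInverse.
Variables (n : nat) (G : rel 'I_n).

Definition hamiltonian (s : seq 'I_n) : Prop :=
  [/\ uniq s, (forall w, w \in s) & forall i j, G i j = (j == next s i) || (i == next s j)].

(** No vertex is isolated, so the cycle covers all vertices and the membership tests of [is_cycle]
    disappear. *)
Lemma is_cycle_hamiltonian l : simple_graph G -> is_cycle G l ->
  exists2 s, size s = l & hamiltonian s.
Proof.
move=> [_ _ Gnb] [_ [s [sl us Gs]]]; exists s => //.
have cover w : w \in s.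
  have [j] := Gnb w; rewrite Gs => /orP[/andP[]//|/andP[js /eqP->]].
  by rewrite mem_next.
by split=> // i j; rewrite Gs !cover.
Qed.

Lemma hamiltonian_rot s : hamiltonian s -> hamiltonian (rot 1 s).
Proof.
move=> [us cover Gs]; split=> [|w|i j]; first by rewrite rot_uniq.
  by rewrite mem_rot.
by rewrite !next_rot.
Qed.

Lemma weight_off_seq (s : seq 'I_n) T (m : 'X_{1..n}) : uniq s -> (forall w, w \in s) ->
  weight_off T m = \sum_(t <- s) if ~~ T t then m t else 0%N.
Proof.
move=> us cover; rewrite big_uniq // /weight_off big_mkcond /=.
by apply: eq_bigl => t; rewrite cover.
Qed.

Lemma pair_le_mnm i j p q (m : 'X_{1..n}) :
  (forall x, (i == x) + (j == x) + ((p == x) + (q == x)) <= m x)%N ->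
  (U_(i) + U_(j) + (U_(p) + U_(q)) <= m)%MM.
Proof.
by move=> h; apply/mnm_lepP => x; rewrite !mnmDE !mnm1E; apply: h.
Qed.

Lemma uniq4E (a b c d : 'I_n) : uniq [:: a; b; c; d] ->
  ((a == b) = false) * ((a == c) = false) * ((a == d) = false) *
  ((b == c) = false) * ((b == d) = false) * ((c == d) = false) *
  (((b == a) = false) * ((c == a) = false) * ((d == a) = false) *
  ((c == b) = false) * ((d == b) = false) * ((d == c) = false)).
Proof.
rewrite /= !inE !negb_or andbT => /and3P[/and3P[ab ac ad] /andP[bc bd] cd].
by do !split; apply/negbTE; rewrite // eq_sym.
Qed.

Lemma uniq5E (a b c d e : 'I_n) : uniq [:: a; b; c; d; e] ->
  ((a == b) = false) * ((a == c) = false) * ((a == d) = false) * ((a == e) = false) *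
  ((b == c) = false) * ((b == d) = false) * ((b == e) = false) *
  ((c == d) = false) * ((c == e) = false) * ((d == e) = false) *
  (((b == a) = false) * ((c == a) = false) * ((d == a) = false) * ((e == a) = false) *
  ((c == b) = false) * ((d == b) = false) * ((e == b) = false) *
  ((d == c) = false) * ((e == c) = false) * ((e == d) = false)).
Proof.
rewrite /= !inE !negb_or andbT.
move=> /and4P[/and4P[ab ac ad ae] /and3P[bc bd be] /andP[cd ce] de].
by do !split; apply/negbTE; rewrite // eq_sym.
Qed.

Section Square.
Variables (a b c d : 'I_n).
Hypothesis abcd : hamiltonian [:: a; b; c; d].

(** The complement of an edge is the opposite edge, so consecutive exponents have sum at least 2.
    Either all exponents are positive, or one is 0 and both its neighbours are at least 2; these
    cases give products of the two diagonals x_a x_c and x_b x_d. *)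
Lemma square_nonface2 m :
  (forall i j, G i j -> 2 <= weight_off (pred2 i j) m)%N -> nonface2 G m.
Proof.
move=> hw; have [us cover Gs] := abcd; have neqs := (uniq4E us, eqxx).
have wE i j := weight_off_seq (pred2 i j) m us cover.
have [Gab Gbc Gcd Gda] : [/\ G a b, G b c, G c d & G d a].
  by split; rewrite Gs /= ?neqs.
have nac : ~~ G a c by rewrite Gs /= ?neqs.
have nca : ~~ G c a by rewrite Gs /= ?neqs.
have nbd : ~~ G b d by rewrite Gs /= ?neqs.
have ndb : ~~ G d b by rewrite Gs /= ?neqs.
have := (hw _ _ Gab, hw _ _ Gbc, hw _ _ Gcd, hw _ _ Gda).
rewrite !wE !big_cons !big_nil /= !neqs /= => -[[[h1 h2] h3] h4].
have use i j p q : i != j -> ~~ G i j -> ~~ G j i -> p != q -> ~~ G p q -> ~~ G q p ->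
    (forall x, (i == x) + (j == x) + ((p == x) + (q == x)) <= m x)%N -> nonface2 G m.
  by move=> ? ? ? ? ? ? /pair_le_mnm; apply: nonface2_pairs.
have : [|| (2 <= m a) && (2 <= m c), (2 <= m b) && (2 <= m d)
    | [&& 1 <= m a, 1 <= m b, 1 <= m c & 1 <= m d]]%N.
  by move: h1 h2 h3 h4; clear; lia.
case/or3P=> [/andP[ma mc]|/andP[mb md]|/and4P[ma mb mc md]].
- apply: (use a c a c); rewrite ?neqs // => x.
  by move: (cover x); rewrite !inE => /or4P[]/eqP->; rewrite ?neqs.
- apply: (use b d b d); rewrite ?neqs // => x.
  by move: (cover x); rewrite !inE => /or4P[]/eqP->; rewrite ?neqs.
- apply: (use a c b d); rewrite ?neqs // => x.
  by move: (cover x); rewrite !inE => /or4P[]/eqP->; rewrite ?neqs.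
Qed.

Lemma square_diam i j : i != j -> ~~ G i j -> exists t, G i t && G t j.
Proof.
have [us cover Gs] := abcd; have neqs := (uniq4E us, eqxx).
move: (cover i) (cover j); rewrite !inE => /or4P[]/eqP-> /or4P[]/eqP->;
  rewrite ?neqs ?Gs /= ?neqs //= => _ _;
  [exists b|exists a|exists b|exists a]; by rewrite !Gs /= ?neqs /= ?orbT.
Qed.

Lemma square_coloring :
  exists col : 'I_n -> 'I_3, forall i j, G i j -> col i != col j.
Proof.
have [us cover Gs] := abcd; have neqs := (uniq4E us, eqxx).
exists (fun i => if (i == a) || (i == c) then inord 0 else inord 1) => i j.
move: (cover i) (cover j); rewrite !inE => /or4P[]/eqP-> /or4P[]/eqP->;
  by rewrite ?neqs ?Gs /= ?neqs //= => _; rewrite -val_eqE /= !inordK.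
Qed.

End Square.

Section Pentagon.
Implicit Types (a b c d e : 'I_n) (m : 'X_{1..n}).

Lemma pentagon_edges a b c d e : hamiltonian [:: a; b; c; d; e] ->
  [/\ [/\ G a b, G b c, G c d, G d e & G e a],
      [/\ ~~ G a c, ~~ G a d, ~~ G b d, ~~ G b e & ~~ G c e] &
      [/\ ~~ G c a, ~~ G d a, ~~ G d b, ~~ G e b & ~~ G e c]].
Proof.
move=> [us cover Gs]; have neqs := (uniq5E us, eqxx).
by do 2!split; rewrite !Gs /= ?neqs /= ?neqs.
Qed.

(** Two diagonals of a pentagon are equal, share an end or cross; up to rotation the three
    alternatives are divisibility by these products. *)
Lemma pentagon_nonface2_aux a b c d e m : hamiltonian [:: a; b; c; d; e] ->
  [|| (2 <= m a) && (2 <= m c), [&& 2 <= m a, 1 <= m c & 1 <= m d]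
   | [&& 1 <= m a, 1 <= m b, 1 <= m c & 1 <= m d]]%N ->
  nonface2 G m.
Proof.
move=> h; have [us cover Gs] := h; have neqs := (uniq5E us, eqxx).
have [_ [nac nad nbd nbe nce] [nca nda ndb neb nec]] := pentagon_edges h.
have use i j p q : i != j -> ~~ G i j -> ~~ G j i -> p != q -> ~~ G p q -> ~~ G q p ->
    (forall x, (i == x) + (j == x) + ((p == x) + (q == x)) <= m x)%N -> nonface2 G m.
  by move=> ? ? ? ? ? ? /pair_le_mnm; apply: nonface2_pairs.
case/or3P=> [/andP[ma mc]|/and3P[ma mc md]|/and4P[ma mb mc md]].
- apply: (use a c a c); rewrite ?neqs // => x.
  by move: (cover x); rewrite !inE => /orP[/eqP->|/or4P[]/eqP->]; rewrite ?neqs.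
- apply: (use a c a d); rewrite ?neqs // => x.
  by move: (cover x); rewrite !inE => /orP[/eqP->|/or4P[]/eqP->]; rewrite ?neqs.
- apply: (use a c b d); rewrite ?neqs // => x.
  by move: (cover x); rewrite !inE => /orP[/eqP->|/or4P[]/eqP->]; rewrite ?neqs.
Qed.

Lemma pentagon_exponents (x0 x1 x2 x3 x4 : nat) :
  let P x y z t := [|| (2 <= x) && (2 <= z), [&& 2 <= x, 1 <= z & 1 <= t]
    | [&& 1 <= x, 1 <= y, 1 <= z & 1 <= t]]%N in
  (2 <= x2 + x3 + x4)%N -> (2 <= x3 + x4 + x0)%N -> (2 <= x4 + x0 + x1)%N ->
  (2 <= x0 + x1 + x2)%N -> (2 <= x1 + x2 + x3)%N ->
  [|| P x0 x1 x2 x3, P x1 x2 x3 x4, P x2 x3 x4 x0, P x3 x4 x0 x1 | P x4 x0 x1 x2].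
Proof.
(* It only matters whether an exponent is 0, 1 or at least 2, which leaves 3^5 cases. *)
move=> P; rewrite {}/P; case: x0 => [|[|x0]]; case: x1 => [|[|x1]]; case: x2 => [|[|x2]];
  by case: x3 => [|[|x3]]; case: x4 => [|[|x4]].
Qed.

Lemma pentagon_nonface2 a b c d e m : hamiltonian [:: a; b; c; d; e] ->
  (forall i j, G i j -> 2 <= weight_off (pred2 i j) m)%N -> nonface2 G m.
Proof.
move=> h hw; have [us cover Gs] := h; have neqs := (uniq5E us, eqxx).
have wE i j := weight_off_seq (pred2 i j) m us cover.
have [[Gab Gbc Gcd Gde Gea] _ _] := pentagon_edges h.
have := (hw _ _ Gab, hw _ _ Gbc, hw _ _ Gcd, hw _ _ Gde, hw _ _ Gea).
rewrite !wE !big_cons !big_nil /= !neqs /= => -[[[[h1 h2] h3] h4] h5].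
have h' := hamiltonian_rot h; have h'' := hamiltonian_rot h'.
have h3' := hamiltonian_rot h''; have h4' := hamiltonian_rot h3'.
have k x y z : (2 <= x + (y + (z + 0)) -> 2 <= x + y + z)%N by rewrite addn0 addnA.
have k4 : (2 <= m d + m e + m a)%N by move: h2; clear; lia.
have k5 : (2 <= m e + m a + m b)%N by move: h3; clear; lia.
case/orP: (pentagon_exponents (k _ _ _ h1) k4 k5 (k _ _ _ h4) (k _ _ _ h5)) => [|/or4P[]].
- exact: pentagon_nonface2_aux h.
- exact: pentagon_nonface2_aux h'.
- exact: pentagon_nonface2_aux h''.
- exact: pentagon_nonface2_aux h3'.
- exact: pentagon_nonface2_aux h4'.
Qed.

Lemma pentagon_diam a b c d e i j : hamiltonian [:: a; b; c; d; e] ->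
  i != j -> ~~ G i j -> exists t, G i t && G t j.
Proof.
move=> h; have [us cover Gs] := h; have neqs := (uniq5E us, eqxx).
move: (cover i) (cover j); rewrite !inE.
move=> /orP[/eqP->|/or4P[]/eqP->] /orP[/eqP->|/or4P[]/eqP->];
  rewrite ?neqs ?Gs /= ?neqs //= => _ _;
  solve [exists a; by rewrite !Gs /= ?neqs | exists b; by rewrite !Gs /= ?neqs
        |exists c; by rewrite !Gs /= ?neqs | exists d; by rewrite !Gs /= ?neqs
        |exists e; by rewrite !Gs /= ?neqs].
Qed.

Lemma pentagon_coloring a b c d e : hamiltonian [:: a; b; c; d; e] ->
  exists col : 'I_n -> 'I_3, forall i j, G i j -> col i != col j.
Proof.
move=> h; have [us cover Gs] := h; have neqs := (uniq5E us, eqxx).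
exists (fun i => if (i == a) || (i == c) then inord 0
                 else if (i == b) || (i == d) then inord 1 else inord 2) => i j.
move: (cover i) (cover j); rewrite !inE.
move=> /orP[/eqP->|/or4P[]/eqP->] /orP[/eqP->|/or4P[]/eqP->];
  by rewrite ?neqs ?Gs /= ?neqs //= => _; rewrite -val_eqE /= !inordK.
Qed.

End Pentagon.
End CycleInverse.

Lemma cycle_4_5_properties n (G : rel 'I_n) :
  simple_graph G -> is_cycle G 4 \/ is_cycle G 5 ->
  [/\ forall m, (forall i j, G i j -> 2 <= weight_off (pred2 i j) m)%N -> nonface2 G m,
      forall i j, i != j -> ~~ G i j -> exists t, G i t && G t j &
      exists col : 'I_n -> 'I_3, forall i j, G i j -> col i != col j].
Proof.
move=> sG [] /(is_cycle_hamiltonian sG)[].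
  move=> [|a [|b [|c [|d [|? ?]]]]] // _ h; split.
  - by move=> m hm; apply: (square_nonface2 h).
  - exact: square_diam h.
  - exact: square_coloring h.
move=> [|a [|b [|c [|d [|e [|? ?]]]]]] // _ h; split.
- by move=> m hm; apply: (pentagon_nonface2 h).
- by move=> i j; exact: pentagon_diam h.
- exact: pentagon_coloring h.
Qed.

(** * Algebraic dependence *)

(** Here [c] is the lowest nonzero coefficient of [F]. Applied to one variable after another, this
    turns a polynomial relation into the nested form of [krull_dim_le2]. *)
Lemma horner_low_coef (T R : comNzRingType) (e : {rmorphism T -> R}) (x : R) (F : {poly T}) :
  F != 0 -> exists m c a, c != 0 /\ (map_poly e F).[x] = x ^+ m * (e c + a * x).
Proof.
elim/poly_ind: F => [|F c IH]; first by rewrite eqxx.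
have [->|c0 _] := eqVneq c 0; last first.
  exists 0%N, c, (map_poly e F).[x]; split=> //.
  by rewrite rmorphD rmorphM /= map_polyX map_polyC !hornerE addrC.
rewrite addr0 => FX0; have [|m [b [a [b0 eF]]]] := IH.
  by apply: contraNneq FX0 => ->; rewrite mul0r.
exists m.+1, b, a; split=> //.
by rewrite rmorphM /= map_polyX hornerMX eF mulrC exprS mulrA.
Qed.

Section AlgebraicDependence.
Variables (k : fieldType) (n : nat).
Implicit Types (f g : {mpoly k[n]}) (a : 'X_{1..n}).

Definition degree_le d f : Prop := forall a, f@_a != 0 -> (mdeg a <= d)%N.

Lemma degree_leM d e f g : degree_le d f -> degree_le e g -> degree_le (d + e) (f * g).
Proof.
move=> hf hg a /mcoeffM_neq0[b [c [-> /hf hb /hg hc]]].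
by rewrite mdegD leq_add.
Qed.

Lemma degree_leX d f m : degree_le d f -> degree_le (m * d) (f ^+ m).
Proof.
move=> hf; elim: m => [|m IH]; last by rewrite exprS mulSn; apply: degree_leM.
by move=> a; rewrite expr0 mcoeff1; case: (a =P 0%MM) => [->|]; rewrite ?mdeg0 ?eqxx.
Qed.

Lemma degree_leP f : degree_le (msize f) f.
Proof. by move=> a; rewrite -mcoeff_msupp => /msize_mdeg_lt/ltnW. Qed.

Definition eval1 f : {rmorphism {poly k} -> {mpoly k[n]}} :=
  horner_morph (fun c => mulrC f (mpolyC n c)).
Definition eval2 f g : {rmorphism {poly {poly k}} -> {mpoly k[n]}} :=
  horner_morph (fun c => mulrC f (eval1 g c)).
Definition eval3 f g h : {rmorphism {poly {poly {poly k}}} -> {mpoly k[n]}} :=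
  horner_morph (fun c => mulrC f (eval2 g h c)).

(** A dimension count modulo the prime of [i] and [j]: the D^3 products of powers with exponents
    below D have degree below L, so they are combinations of at most L^2 monomials in X_i and
    X_j. *)
Lemma algebraic_dependence (i j : 'I_n) f0 f1 f2 : i != j ->
  exists2 F, F != 0 & forall a, (eval3 f0 f1 f2 F)@_a != 0 -> (0 < weight_off (pred2 i j) a)%N.
Proof.
move=> ij; pose d := (msize f0 + msize f1 + msize f2)%N.
have h0 : degree_le d f0 
  by move=> a ha; apply: (leq_trans (degree_leP ha)); rewrite /d; lia.
have h1 : degree_le d f1 
  by move=> a ha; apply: (leq_trans (degree_leP ha)); rewrite /d; lia.
have h2 : degree_le d f2 
  by move=> a ha; apply: (leq_trans (degree_leP ha)); rewrite /d; lia.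
(* The products have degree at most 3 D d. As L is at most 3 D (d + 1), its square is at most 9 D^2
   (d + 1)^2, which is below D^3 for D = 16 (d + 1)^2. *)
have [D [L [eL DL]]] : exists D L, L = (3 * D * d).+1 /\ (L * L < D * D * D)%N.
  pose D := (16 * d.+1 * d.+1)%N; exists D, (3 * D * d).+1; split=> //.
  have D0 : (0 < D * D)%N by rewrite muln_gt0 andbb.
  have LD : (3 * D * d < 3 * D * d.+1)%N by rewrite ltn_pmul2l // muln_gt0 andbT.
  apply: leq_ltn_trans (leq_mul LD LD) _.
  have key (x y : nat) : (0 < x * x)%N -> (0 < y)%N ->
      (3 * x * y * (3 * x * y) < x * x * (16 * y * y))%N.
    move=> x0 y0; have : (0 < (x * x) * (y * y))%N by rewrite !muln_gt0 y0 -muln_gt0 x0.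
    have -> : (3 * x * y * (3 * x * y) = 9 * ((x * x) * (y * y)))%N by lia.
    have -> : (x * x * (16 * y * y) = 16 * ((x * x) * (y * y)))%N by lia.
    by clear; lia.
  exact: key.
pose I : finType := ('I_D * 'I_D * 'I_D)%type; pose J : finType := ('I_L * 'I_L)%type.
pose mon (r : I) := f0 ^+ r.1.1 * f1 ^+ r.1.2 * f2 ^+ r.2.
pose A : 'M[k]_(#|I|, #|J|) := \matrix_(r < #|I|, c < #|J|)
  (mon (enum_val r))@_(U_(i) *+ (enum_val c : J).1 + U_(j) *+ (enum_val c : J).2).
have : kermx A != 0.
  rewrite -mxrank_eq0 mxrank_ker subn_eq0 -ltnNge.
  by apply: leq_ltn_trans (rank_leq_col A) _; rewrite !card_prod !card_ord.
case/rowV0Pn=> v /sub_kermxP vA v0.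
pose c r := v 0 (enum_rank r).
pose F : {poly {poly {poly k}}} := \sum_(r : I)
  (((c r)%:P * 'X^(r.2))%:P * 'X^(r.1.2))%:P * 'X^(r.1.1).
exists F.
  apply: contra_neq v0 => F0; apply/rowP => r; rewrite mxE.
  have := congr1 (fun p : {poly {poly {poly k}}} =>
    p`_((enum_val r).1.1)`_((enum_val r).1.2)`_((enum_val r).2)) F0.
  rewrite !coef0 => <-; rewrite /F !coef_sum (bigD1 (enum_val r)) //=.
  rewrite !(coefCM, coefXn, eqxx, mulr1) /c enum_valK big1 ?addr0 // => s sr.
  rewrite coefCM coefXn mulr_natr coefMn coefCM coefXn mulr_natr !coefMn coefCM coefXn.
  case: eqP => [e1|]; last by rewrite /= ?mulr0n ?mulr0 ?mul0rn.
  case: eqP => [e2|]; last by rewrite /= ?mulr0n ?mulr0 ?mul0rn.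
  case: eqP => [e3|]; last by rewrite /= ?mulr0n ?mulr0 ?mul0rn.
  case/eqP: sr; move: e1 e2 e3; case: s => [[s1 s2] s3].
  by case: (enum_val r) => [[r1 r2] r3] /= /val_inj-> /val_inj-> /val_inj->.
have evF : eval3 f0 f1 f2 F = \sum_(r : I) (c r) *: mon r.
  rewrite rmorph_sum; apply: eq_bigr => r _.
  rewrite rmorphM rmorphXn /= horner_morphC horner_morphX.
  rewrite rmorphM rmorphXn /= horner_morphC horner_morphX.
  rewrite rmorphM rmorphXn /= horner_morphC horner_morphX.
  rewrite -mul_mpolyC /mon -!mulrA; congr (_ * _).
  by rewrite mulrC -mulrA mulrCA.
move=> a; rewrite lt0n; apply: contra_neq => wa; rewrite evF raddf_sum /=.
have [aL|aL] := ltnP (mdeg a) L; last first.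
  rewrite big1 // => r _; rewrite mcoeffZ.
  suff -> : (mon r)@_a = 0 by rewrite mulr0.
  apply: contraTeq aL => ra; rewrite -ltnNge eL ltnS.
  have hr := degree_leM (degree_leM (degree_leX (m := r.1.1) h0)
    (degree_leX (m := r.1.2) h1)) (degree_leX (m := r.2) h2).
  apply: leq_trans (hr a ra) _.
  have [l1 [l2 l3]] : (r.1.1 <= D)%N /\ (r.1.2 <= D)%N /\ (r.2 <= D)%N by do !split; apply: ltnW.
  by rewrite -!mulnDl leq_mul2r; apply/orP; right; move: l1 l2 l3; clear; lia.
have ait t : (a t <= mdeg a)%N by rewrite mdegE (bigD1 t) //= leq_addr.
pose s : J := (Ordinal (leq_ltn_trans (ait i) aL), Ordinal (leq_ltn_trans (ait j) aL)).
have ea : a = (U_(i) *+ a i + U_(j) *+ a j)%MM.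
  apply/mnmP => t; rewrite mnmDE !mulmnE !mnm1E.
  have [<-|it] := eqVneq i t; first by rewrite eq_sym (negPf ij) mul0n mul1n addn0.
  have [<-|jt] := eqVneq j t; first by rewrite mul1n.
  apply/eqP; rewrite -leqn0 -wa; apply: leq_weight_off.
  by rewrite /= !(eq_sym t) negb_or it jt.
have := congr1 (fun M : 'rV_#|J| => M 0 (enum_rank s)) vA; rewrite !mxE; apply: etrans.
rewrite [RHS](reindex _ (onW_bij _ (enum_rank_bij I))) /=; apply: eq_bigr => r _.
by rewrite mcoeffZ !mxE !enum_rankK /= -ea.
Qed.

End AlgebraicDependence.

(** The product of the dependences for the different edges evaluates into every edge prime, hence
    into I, and its square into I^2. *)
Theorem krull_dim_le2_nonface2 (k : fieldType) n (G : rel 'I_n) (R : comNzRingType)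
    (p : {rmorphism {mpoly k[n]} -> R}) :
  irreflexive G -> (forall y, exists x, p x = y) ->
  (forall x, monomial_span (nonface2 G) x -> p x = 0) -> krull_dim_le2 R.
Proof.
move=> Girr psurj pK y0 y1 y2.
have [f0 <-] := psurj y0; have [f1 <-] := psurj y1; have [f2 <-] := psurj y2.
have /choice[F hF] : forall e : 'I_n * 'I_n, exists F : {poly {poly {poly k}}}, F != 0 /\
    (G e.1 e.2 -> monomial_span (fun a => (0 < weight_off (pred2 e.1 e.2) a)%N)
       (eval3 f0 f1 f2 F)).
  move=> [i j]; have [ij|ij] := eqVneq i j; last first.
    by have [F ? ?] := algebraic_dependence f0 f1 f2 ij; exists F.
  by exists 1; rewrite oner_eq0 /= ij Girr.
pose H := (\prod_e F e) ^+ 2.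
have H0 : H != 0 by rewrite expf_neq0 //; apply/prodf_neq0 => e _; have [] := hF e.
have KH : monomial_span (nonface2 G) (eval3 f0 f1 f2 H).
  rewrite rmorphXn expr2 => a /mcoeffM_neq0[b [c [-> hb hc]]].
  suff nf d : (eval3 f0 f1 f2 (\prod_e F e))@_d != 0 -> nonface G d.
    by exists b, c; split=> //; apply: nf.
  move=> hd i j Gij; have [_ /(_ Gij) hi] := hF (i, j); move: hd.
  rewrite (bigD1 (i, j)) //= rmorphM.
  have I_ := @monomial_span_ideal n k (fun a => (0 < weight_off (pred2 i j) a)%N).
  apply: (ideal_mulr _ (I_ _) hi).
  by move=> a' b' ha; rewrite weight_offD addn_gt0 ha orbT.
have [m0 [H1 [a0 [H10 e0]]]] := @horner_low_coef _ _ (eval2 f1 f2) f0 H H0.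
have [m1 [H2 [a1 [H20 e1]]]] := @horner_low_coef _ _ (eval1 f2) f1 H1 H10.
have [m2 [c [a2 [c0 e2]]]] := @horner_low_coef _ _ (@mpolyC n k) f2 H2 H20.
(* Dividing by the last coefficient [c], a nonzero scalar, normalises the innermost term to 1. *)
pose C := (c^-1)%:MP_[n]; exists m0, m1, m2, (p (C * a0)), (p (C * a1)), (p (C * a2)).
have : p (C * eval3 f0 f1 f2 H) = 0.
  by rewrite rmorphM (pK _ KH) mulr0.
have -> : eval3 f0 f1 f2 H = f0 ^+ m0 * (f1 ^+ m1 * (f2 ^+ m2 * (c%:MP + a2 * f2)
    + a1 * f1) + a0 * f0).
  rewrite [LHS]e0 -[eval2 f1 f2 H1]/((map_poly (eval1 f2) H1).[f1]) e1.
  by rewrite -[eval1 f2 H2]/((map_poly (@mpolyC n k) H2).[f2]) e2.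
have : p C * p c%:MP = 1 by rewrite -rmorphM -mpolyCM mulVf // rmorph1.
rewrite !(rmorphXn, rmorphM, rmorphD) => <- <-; move: (p f0 ^+ m0) (p f1 ^+ m1) (p f2 ^+ m2).
by move=> g0 g1 g2; ring.
Qed.

(** * Maximal ideals and chains of primes *)

Section Morphisms.
Variables (k : fieldType) (n : nat).
Local Notation S := {mpoly k[n]}.

Lemma eq_mpoly_rmorph (T : comNzRingType) (f g : {rmorphism S -> T}) :
  (forall c, f c%:MP = g c%:MP) -> (forall i, f 'X_i = g 'X_i) -> f =1 g.
Proof.
move=> fgC fgX; elim/mpolyind => [|c m q _ _ IH]; first by rewrite !rmorph0.
rewrite !rmorphD IH -mul_mpolyC !rmorphM fgC mpolyXE_id !rmorph_prod.
by congr (_ * _ + _); apply: eq_bigr => i _; rewrite !rmorphXn fgX.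
Qed.

Definition mpoly_horner (P : {poly k}) (x : S) : S := (map_poly (@mpolyC n k) P).[x].

Lemma rmorph_mpoly_horner (T : comNzRingType) (f : {rmorphism S -> T}) P x :
  f (mpoly_horner P x) = (map_poly (f \o @mpolyC n k) P).[f x].
Proof. by rewrite /mpoly_horner -horner_map -map_poly_comp. Qed.

Lemma mpoly_horner_neq0 P i : P != 0 -> mpoly_horner P 'X_i != 0.
Proof.
apply: contra_neq => /(congr1 (mmap (@polyC k) (fun=> 'X))).
rewrite rmorph_mpoly_horner rmorph0 /= mmapX mmap1U.
rewrite (eq_map_poly (g := polyC)); last by move=> c; rewrite /= mmapC.
by rewrite -/(P \Po 'X) comp_polyXr.
Qed.

Variable G : rel 'I_n.
Local Notation K2 := (monomial_span (k := k) (nonface2 G)).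

Lemma rmorph_nonface2 (T : comNzRingType) (f : {rmorphism S -> T}) i j :
  G i j -> (forall t, t != i -> t != j -> f 'X_t = 0) -> forall x, K2 x -> f x = 0.
Proof.
move=> Gij f0; apply: (@monomial_span_sub _ _ _ [set x | f x = 0]).
  split=> /= [|x y fx fy|a x fx]; first by rewrite rmorph0.
    by rewrite rmorphD fx fy addr0.
  by rewrite rmorphM fx mulr0.
move=> _ [b [c [hb _ ->]]] /=.
have [t] := weight_off_gt0 (hb i j Gij); rewrite /= negb_or => /andP[ti tj] /mnm_addU[d ->].
by rewrite !mpolyXD !rmorphM f0 // !mul0r.
Qed.

Variables (R : comNzRingType) (p : {rmorphism S -> R}).
Hypotheses (p_surj : forall y, exists x, p x = y) (p_ker : forall x, p x = 0 <-> K2 x).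

(** Ideals of [R] are presented by morphisms on S: one into a domain that kills I^2 gives a prime,
    and strict inclusions can be tested on polynomials. *)
Definition image_ker (T : comNzRingType) (f : {rmorphism S -> T}) : set R :=
  [set y | exists2 x, p x = y & f x = 0].

Lemma image_kerE (T : comNzRingType) (f : {rmorphism S -> T}) x :
  (forall x, K2 x -> f x = 0) -> image_ker f (p x) <-> f x = 0.
Proof.
move=> fK; split=> [[y /eqP]|fx]; last by exists x.
rewrite -subr_eq0 -rmorphB => /eqP/p_ker/fK/eqP.
by rewrite rmorphB subr_eq0 => /eqP->.
Qed.

Lemma image_ker_prime (T : idomainType) (f : {rmorphism S -> T}) :
  (forall x, K2 x -> f x = 0) -> prime_ideal (image_ker f).
Proof.
move=> fK; apply/prime_idealP; split.
- split=> [|_ _ [x <- fx] [y <- fy]|a _ [x <- fx]].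
  + by exists 0; rewrite rmorph0.
  + by exists (x + y); rewrite rmorphD // fx fy addr0.
  + by have [b <-] := p_surj a; exists (b * x); rewrite rmorphM // fx mulr0.
- by rewrite -(rmorph1 p) => /image_kerE-/(_ fK)/eqP; rewrite rmorph1 oner_eq0.
- move=> y z; have [a <-] := p_surj y; have [b <-] := p_surj z.
  rewrite -rmorphM => /image_kerE-/(_ fK)/eqP; rewrite rmorphM mulf_eq0.
  by move=> /orP[]/eqP/image_kerE-/(_ fK); [left|right].
Qed.

(* The chain consists of the kernels of the maps from S to k[X_i, X_j], to K[X_j]
   and to K. *)
Lemma height_ge2 (K : fieldType) (f : {rmorphism S -> K}) i j : i != j -> G i j ->
  (forall t, t != i -> t != j -> f 'X_t = 0) ->
  algebraicOver (f \o @mpolyC n k) (f 'X_i) ->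
  algebraicOver (f \o @mpolyC n k) (f 'X_j) ->
  prime_chain_lengths (image_ker f) 2.
Proof.
move=> ij Gij f0 [P P0 /eqP Pi] [Q Q0 /eqP Qj].
(* The ring k[X_i, X_j] is realised as a subring of S. *)
pose f0' : {rmorphism S -> S} :=
  mmap (@mpolyC n k) (fun t => if (t == i) || (t == j) then 'X_t else 0).
pose f1 : {rmorphism S -> {poly K}} := mmap (polyC \o (f \o @mpolyC n k))
  (fun t => if t == i then (f 'X_i)%:P else if t == j then 'X else 0).
have f0X t : f0' 'X_t = if (t == i) || (t == j) then 'X_t else 0 by rewrite /= mmapX mmap1U.
have f1X t : f1 'X_t = if t == i then (f 'X_i)%:P else if t == j then 'X else 0.
  by rewrite /= mmapX mmap1U.
have f0C c : f0' c%:MP = c%:MP by exact: mmapC.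
have f1C c : f1 c%:MP = (f c%:MP)%:P by exact: mmapC.
have f10 x : f1 (f0' x) = f1 x.
  apply: (eq_mpoly_rmorph (f := f1 \o f0')) => [c|t].
    by rewrite -[LHS]/(f1 (f0' _)) f0C.
  rewrite -[LHS]/(f1 (f0' _)) f0X; case: ifP => // /negbT.
  by rewrite negb_or rmorph0 f1X => /andP[/negPf-> /negPf->].
have f1f x : (f1 x).[f 'X_j] = f x.
  apply: (eq_mpoly_rmorph (f := horner_eval (f 'X_j) \o f1)) => [c|t].
    by rewrite -[LHS]/((f1 _).[_]) f1C hornerC.
  rewrite -[LHS]/((f1 _).[_]) f1X; have [->|ti] := eqVneq t i; first by rewrite hornerC.
  by have [->|tj] := eqVneq t j; rewrite ?hornerX // hornerC f0.
have K0 : forall x, K2 x -> f0' x = 0.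
  by apply: rmorph_nonface2 Gij _ => t ti tj; rewrite f0X (negPf ti) (negPf tj).
have K1 : forall x, K2 x -> f1 x = 0.
  by apply: rmorph_nonface2 Gij _ => t ti tj; rewrite f1X (negPf ti) (negPf tj).
have KK : forall x, K2 x -> f x = 0 by apply: rmorph_nonface2 Gij _.
exists (fun l => if l is 0%N then image_ker f0' else if l is 1%N then image_ker f1
                 else image_ker f); split=> //.
  by move=> [|[|l]] _; apply: image_ker_prime.
move=> [|[|//]] _; split.
- by move=> _ [x <- fx]; exists x; rewrite // -f10 fx rmorph0.
(* P(X_i) separates the first two kernels; below, Q(X_j) separates the last two. *)
- move=> /(_ (p (mpoly_horner P 'X_i)))/= h.
  have /image_kerE-/(_ K0) : image_ker f0' (p (mpoly_horner P 'X_i)).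
    apply: h; apply/image_kerE => //.
    rewrite rmorph_mpoly_horner f1X eqxx.
    rewrite (eq_map_poly (g := polyC \o (f \o @mpolyC n k))); last exact: f1C.
    by rewrite map_poly_comp horner_map Pi.
  rewrite rmorph_mpoly_horner f0X eqxx (eq_map_poly (g := @mpolyC n k)) //.
  exact/eqP/mpoly_horner_neq0.
- by move=> _ [x <- fx]; exists x; rewrite // -f1f fx horner0.
- move=> /(_ (p (mpoly_horner Q 'X_j)))/= h.
  have /image_kerE-/(_ K1) : image_ker f1 (p (mpoly_horner Q 'X_j)).
    by apply: h; apply/image_kerE => //; rewrite rmorph_mpoly_horner Qj.
  rewrite rmorph_mpoly_horner f1X eq_sym (negPf ij) eqxx.
  rewrite (eq_map_poly (g := polyC \o (f \o @mpolyC n k))); last exact: f1C.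
  rewrite map_poly_comp -/(_ \Po 'X) comp_polyXr => /eqP; rewrite map_poly_eq0.
  by rewrite (negPf Q0).
Qed.

Lemma maximal_ideal_residue (m : set R) : irreflexive G -> maximal_ideal m ->
  exists (K : fieldType) (f : {rmorphism S -> K}) i j,
    [/\ m = image_ker f, i != j, G i j, (forall t, t != i -> t != j -> f 'X_t = 0) &
        algebraicOver (f \o @mpolyC n k) (f 'X_i) /\
        algebraicOver (f \o @mpolyC n k) (f 'X_j)].
Proof.
move=> Girr /(maximal_ideal_preim p_surj)/residue_field[K [f [f_surj ker_f]]].
have mE x : m (p x) <-> f x = 0.
  have /seteqP[h1 h2] := ker_f; split; [exact: h1|exact: h2].
have m0 : m 0 by rewrite -(rmorph0 p); apply/mE; rewrite rmorph0.
have fK x : K2 x -> f x = 0 by move=> /p_ker px; apply/mE; rewrite px.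
have [i [j [Gij f0]]] : exists i j, G i j /\ (forall t, t != i -> t != j -> f 'X_t = 0).
  apply: contrapT => h.
  (* If the kernel of [f] contained no edge prime, each edge would miss a variable outside the
     kernel; the product of these variables lies in I, so its square would be killed by [f]. *)
  have /choice[t ht] : forall e : 'I_n * 'I_n, exists t,
      G e.1 e.2 -> [/\ t != e.1, t != e.2 & f 'X_t != 0].
    move=> [i j]; apply: contrapT => ht; apply: h; exists i, j.
    split=> [|t ti tj].
      apply/negPn/negP => nG; apply: ht; by exists i; rewrite /= (negPf nG).
    by apply/eqP/negPn/negP => ft; apply: ht; exists t.
  pose a := (\sum_(e | G e.1 e.2) U_(t e))%MM.
  have nf : nonface G a.
    move=> i j Gij; rewrite /a (bigD1 (i, j)) //= weight_offD weight_offU /=.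
    by have [/= /negPf-> /negPf-> _] := ht (i, j) Gij.
  have /fK/eqP : K2 'X_[a + a] by apply/monomial_spanX; exists a, a.
  rewrite mpolyXD rmorphM mulf_eq0 orbb /a.
  rewrite (big_morph _ (@mpolyXD n k) (@mpolyX0 n k)) rmorph_prod.
  by apply/negP/prodf_neq0 => e Ge; have [] := ht e Ge.
have ij : i != j by apply: contraTneq Gij => ->; rewrite Girr.
exists K, f, i, j; split=> //.
  apply/seteqP; split=> y; have [x <-] := p_surj y.
    by move=> /mE fx; exists x.
  by move=> /image_kerE-/(_ fK)/mE.
(* The images of the two remaining variables generate [K] over [k]; Zariski's lemma is applied once
   for each of them. *)
have alg i' j' : i' != j' -> (forall t, t != i' -> t != j' -> f 'X_t = 0) ->
    algebraicOver (f \o @mpolyC n k) (f 'X_i').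
  move=> ij' f0'; apply: (@zariski2 _ _ _ _ (f 'X_j')) => z; have [x <-] := f_surj z.
  pose g : {rmorphism S -> {poly {poly k}}} := mmap (polyC \o @polyC k)
    (fun t => if t == i' then 'X%:P else if t == j' then 'X else 0).
  exists (g x).
  pose ev1 : {rmorphism {poly k} -> K} :=
    horner_morph (fun c => mulrC (f 'X_i') ((f \o @mpolyC n k) c)).
  pose ev2 : {rmorphism {poly {poly k}} -> K} :=
    horner_morph (fun c => mulrC (f 'X_j') (ev1 c)).
  have ev1C c : ev1 c%:P = f c%:MP by exact: horner_morphC.
  have ev2C q : ev2 q%:P = ev1 q by exact: horner_morphC.
  rewrite -[LHS]/(ev2 (g x)); apply: (eq_mpoly_rmorph (f := ev2 \o g)) => [c|t].
    by rewrite -[LHS]/(ev2 (g _)) [g _]mmapC ev2C ev1C.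
  rewrite -[LHS]/(ev2 (g _)) [g _]mmapX mmap1U; have [->|ti] := eqVneq t i'.
    by rewrite ev2C; exact: horner_morphX.
  have [->|tj] := eqVneq t j'; first exact: horner_morphX.
  by rewrite rmorph0 f0'.
by split; [apply: (alg i j)|apply: (alg j i)]; rewrite // 1?eq_sym // => t tj ti; apply: f0.
Qed.

End Morphisms.

(** * The square of an edge prime *)

Section Grading.
Import Order.TTheory.
Variables (k : fieldType) (n : nat).
Local Notation S := {mpoly k[n]}.
Implicit Types (f g p q u : S) (a b c m : 'X_{1..n}) (T : pred 'I_n).

(** The exponents outside [N] span a monomial ideal whose associated primes involve only variables
    outside [T], while [p] has a term in the variables of [T] alone. The proof compares lowest
    terms: for [c] the least exponent of weight 0 in [p], the coefficient of [p * d] at c + a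
    reduces to p_c d_a, by induction on the weight of [a] and then on the monomial order. *)
Lemma nzd_monomials T (N : 'X_{1..n} -> Prop) p d c0 :
  (forall a b, N (a + b)%MM -> N a) ->
  (forall a c, N a -> weight_off T c = 0%N -> N (c + a)%MM) ->
  weight_off T c0 = 0%N -> p@_c0 != 0 ->
  (forall a, N a -> (p * d)@_a = 0) -> forall a, N a -> d@_a = 0.
Proof.
move=> Ndown NT wc0 pc0 pd.
have [c [wc pc cmin]] : exists c, [/\ weight_off T c = 0%N, p@_c != 0 &
    forall c', (c' < c)%O -> weight_off T c' = 0%N -> p@_c' = 0].
  move: wc0 pc0; elim/(well_founded_ind (@ltom_wf n)): c0 => c IH wc pc.
  have [[c' [c'c wc' pc']]|h] :=
    pselect (exists c', [/\ (c' < c)%O, weight_off T c' = 0%N & p@_c' != 0]).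
    exact: IH pc'.
  exists c; split=> // c' c'c wc'; apply/eqP/negPn/negP => pc'.
  by apply: h; exists c'.
move=> a; move em : (weight_off T a) => m; elim/ltn_ind: m a em => m IHm a.
elim/(well_founded_ind (@ltom_wf n)): a => a IHa wa Na.
have := pd _ (NT _ _ Na wc); rewrite mcoeffM.
have c_bd : (mdeg c < (mdeg (c + a)%MM).+1)%N by rewrite ltnS mdegD leq_addr.
have a_bd : (mdeg a < (mdeg (c + a)%MM).+1)%N by rewrite ltnS mdegD leq_addl.
rewrite (bigD1 (BMultinom c_bd, BMultinom a_bd)) //= big1 ?addr0; last first.
  move=> [[x xb] [y yb]] /= /andP[/eqP exy]; rewrite xpair_eqE !bmeqP /= => ne.
  have Ny : N y by apply: (Ndown _ x); rewrite addmC -exy; apply: NT.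
  have ew : (weight_off T x + weight_off T y = m)%N.
    by rewrite -weight_offD -exy weight_offD wc wa.
  case wx : (weight_off T x) => [|w]; last first.
    by rewrite [d@_y](IHm (weight_off T y)) ?mulr0 // -ew wx; lia.
  have wy : weight_off T y = m by rewrite -ew wx.
  case: (ltgtP x c) => [xc|cx|exc].
  - by rewrite cmin ?mul0r.
  - rewrite [d@_y]IHa ?mulr0 //; case: (ltP y a) => // ay.
    by have := ltmc_le_add cx ay; rewrite -exy ltxx.
  - by case/negP: ne; move: exy; rewrite exc => /addmI->; rewrite !eqxx.
by move/eqP; rewrite mulf_eq0 (negPf pc) => /eqP.
Qed.

(* The coefficient of 'X^d is the part of degree d in the variables outside T. *)
Definition off_grading T : {rmorphism S -> {poly S}} :=
  mmap (polyC \o @mpolyC n k) (fun t => if T t then ('X_t)%:P else ('X_t)%:P * 'X).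

Lemma off_gradingX T m : off_grading T 'X_[m] = 'X_[m]%:P * 'X^(weight_off T m).
Proof.
rewrite [LHS]mmapX /mmap1 mpolyXE_id rmorph_prod /weight_off.
rewrite -prodrXr [X in _ * X]big_mkcond -big_split; apply: eq_bigr => i _ /=.
by case: (T i); rewrite ?mulr1 ?rmorphXn //= exprMn.
Qed.

Lemma mcoeff_off_grading T f d a :
  ((off_grading T f)`_d)@_a = if weight_off T a == d then f@_a else 0.
Proof.
elim/mpolyind: f => [|c m f _ _ IH]; first by rewrite rmorph0 coef0 !mcoeff0 if_same.
have FC : off_grading T c%:MP = (c%:MP)%:P by exact: mmapC.
have -> : (if weight_off T a == d then (c *: 'X_[m] + f)@_a else 0) =
    (if weight_off T a == d then (c *: 'X_[m])@_a else 0) +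
    (if weight_off T a == d then f@_a else 0).
  by case: (_ == d); rewrite ?addr0 ?mcoeffD.
rewrite rmorphD coefD [LHS]mcoeffD; congr (_ + _); last exact: IH.
rewrite -mul_mpolyC rmorphM FC off_gradingX mulrA.
rewrite -polyCM coefCM coefXn mulr_natr mcoeffMn mcoeffCM mcoeffX.
have [<-|ma] := eqVneq m a; last by rewrite mulr0 mul0rn if_same.
by rewrite eq_sym; case: (_ == d); rewrite ?mulr1n ?mulr0n.
Qed.

(* Locked, for otherwise unification unfolds the morphism. *)
Fact weight_part_key : unit. Proof. by []. Qed.
Definition weight_part := locked_with weight_part_key (fun T d f => (off_grading T f)`_d).

Lemma weight_partE T d f : weight_part T d f = (off_grading T f)`_d.
Proof. by rewrite /weight_part unlock. Qed.

Lemma mcoeff_weight_part T f d a :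
  (weight_part T d f)@_a = if weight_off T a == d then f@_a else 0.
Proof. by rewrite weight_partE mcoeff_off_grading. Qed.

Lemma weight_part0M T f g : weight_part T 0 (f * g) = weight_part T 0 f * weight_part T 0 g.
Proof. by rewrite !weight_partE rmorphM coefM big_ord_recl big_ord0 addr0. Qed.

Lemma weight_part1M T f g :
  weight_part T 1 (f * g) =
    weight_part T 0 f * weight_part T 1 g + weight_part T 1 f * weight_part T 0 g.
Proof. by rewrite !weight_partE rmorphM coefM !big_ord_recl big_ord0 addr0. Qed.

Lemma weight_partB T d f g : weight_part T d (f - g) = weight_part T d f - weight_part T d g.
Proof. by rewrite !weight_partE rmorphB coefB. Qed.

Lemma weight_part_id T d e f :
  weight_part T d (weight_part T e f) = if d == e then weight_part T e f else 0.
Proof.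
apply/mpolyP => a; rewrite [LHS]mcoeff_weight_part; case: (d =P e) => [->|de].
  by rewrite mcoeff_weight_part; case: eqP.
rewrite mcoeff0; case: eqP => // wd; rewrite mcoeff_weight_part wd.
by case: eqP de.
Qed.

Lemma weight_part_eq0P T d f : weight_part T d f = 0 <-> forall a, weight_off T a = d -> f@_a = 0.
Proof.
split=> [h a wa|h]; first by have := mcoeff_weight_part T f d a; rewrite wa eqxx h mcoeff0.
by apply/mpolyP => a; rewrite mcoeff_weight_part mcoeff0; case: eqP => // /h.
Qed.

Local Notation sq T := (monomial_span (k := k) (fun a => (1 < weight_off T a)%N)).

Lemma sq_ideal T : is_ideal (sq T).
Proof. by apply: monomial_span_ideal => a b h; rewrite weight_offD ltn_addl. Qed.

Lemma sqP T f : sq T f <-> forall a, (weight_off T a <= 1)%N -> f@_a = 0.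
Proof.
split=> [h a wa|h a]; first by apply/eqP/negPn/negP => /h; rewrite ltnNge wa.
by apply: contraNltn => /h->.
Qed.

Lemma sq_weight_part T f : sq T f <-> weight_part T 0 f = 0 /\ weight_part T 1 f = 0.
Proof.
split=> [/sqP h|[/weight_part_eq0P h0 /weight_part_eq0P h1]].
  by split; apply/weight_part_eq0P => a wa; apply: h; rewrite wa.
by apply/sqP => a; rewrite leq_eqVlt ltnS leqn0 => /orP[]/eqP; [apply: h1|apply: h0].
Qed.

Definition coprime_pair f g : Prop :=
  forall x y, f * x = g * y -> exists u, x = g * u /\ y = f * u.

(** Successive approximation: the equation is solved in weight 0 by [U0]. After subtraction, the
    weight 1 parts satisfy an equation with the same coefficients, the weight 0 parts of [p] and
    [q], solved by [U1]. *)
Lemma sq_coprime T p q g h : coprime_pair (weight_part T 0 p) (weight_part T 0 q) ->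
  sq T (q * g - p * h) -> exists u, sq T (g - p * u) /\ sq T (h - q * u).
Proof.
move=> cop; rewrite sq_weight_part weight_partB !weight_part0M => -[/eqP].
rewrite subr_eq0 => /eqP e0 e1.
have [u0 [hu0 gu0]] := cop _ _ (esym e0); pose U0 := weight_part T 0 u0.
have gU0 : weight_part T 0 g = weight_part T 0 p * U0.
  by have := congr1 (weight_part T 0) gu0; rewrite weight_part0M !weight_part_id.
have hU0 : weight_part T 0 h = weight_part T 0 q * U0.
  by have := congr1 (weight_part T 0) hu0; rewrite weight_part0M !weight_part_id.
pose g' := g - p * U0; pose h' := h - q * U0.
have g'0 : weight_part T 0 g' = 0 by rewrite weight_partB weight_part0M weight_part_id /= gU0 subrr.
have h'0 : weight_part T 0 h' = 0 by rewrite weight_partB weight_part0M weight_part_id /= hU0 subrr.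
have e1' : weight_part T 0 p * weight_part T 1 h' = weight_part T 0 q * weight_part T 1 g'.
  have : weight_part T 1 (q * g' - p * h') = 0.
    by rewrite -[RHS]e1; congr (weight_part T 1 _); rewrite /g' /h'; ring.
  rewrite weight_partB !weight_part1M g'0 h'0 !mulr0 !addr0 => /eqP.
  by rewrite subr_eq0 => /eqP.
have [u1 [hu1 gu1]] := cop _ _ e1'; pose U1 := weight_part T 1 u1.
have gU1 : weight_part T 1 g' = weight_part T 0 p * U1.
  by have := congr1 (weight_part T 1) gu1; rewrite weight_part1M !weight_part_id /= mul0r addr0.
have hU1 : weight_part T 1 h' = weight_part T 0 q * U1.
  by have := congr1 (weight_part T 1) hu1; rewrite weight_part1M !weight_part_id /= mul0r addr0.
have final x r : weight_part T 0 x = 0 ->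
    weight_part T 1 x = weight_part T 0 r * U1 -> sq T (x - r * U1).
  move=> x0 x1; apply/sq_weight_part.
  rewrite !weight_partB weight_part0M weight_part1M x0 x1 !weight_part_id /=.
  by rewrite !mulr0 addr0 !subrr.
exists (U0 + U1); rewrite !mulrDr !opprD !addrA.
by split; [exact: final g'0 gU1|exact: final h'0 hU1].
Qed.

End Grading.

(** * The symbolic square *)


Section Coprime.
Variables (k : fieldType) (n : nat).
Local Notation S := {mpoly k[n]}.
Implicit Types (f g u : S) (P Q : {poly k}) (i j : 'I_n).

Lemma coprime_pairC f g : coprime_pair f g -> coprime_pair g f.
Proof. by move=> h x y /esym/h[u [-> ->]]; exists u. Qed.

(* Q(b X_i + X_j) is monic in X_j while P(X_i) does not involve X_j. *)
Lemma coprime_horner P Q i j (b : k) : i != j -> P \is monic -> Q \is monic ->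
  coprime_pair (mpoly_horner P ('X_i : S)) (mpoly_horner Q (b *: 'X_i + 'X_j : S)).
Proof.
move=> ij Pm Qm.
pose F : {rmorphism S -> {poly S}} :=
  mmap (polyC \o @mpolyC n k) (fun t => if t == j then 'X else ('X_t)%:P).
have FX t : F 'X_t = if t == j then 'X else ('X_t)%:P by rewrite [LHS]mmapX mmap1U.
have FC c : F c%:MP = (c%:MP)%:P by exact: mmapC.
have FK f : (F f).['X_j] = f.
  apply: (eq_mpoly_rmorph (f := horner_eval 'X_j \o F) (g := idfun)) => [c|t].
    by rewrite -[LHS]/((F _).[_]) FC hornerC.
  by rewrite -[LHS]/((F _).[_]) FX; case: eqP => [->|_]; rewrite ?hornerX ?hornerC.
set A := mpoly_horner P _; set B := mpoly_horner Q _.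
have FA : F A = A%:P.
  rewrite /A rmorph_mpoly_horner FX (negPf ij) (eq_map_poly FC) map_poly_comp.
  by rewrite horner_map.
have FB : F B \is monic.
  rewrite /B rmorph_mpoly_horner rmorphD -mul_mpolyC rmorphM FC !FX eqxx (negPf ij).
  rewrite (eq_map_poly FC) map_poly_comp addrC -polyCM -/(_ \Po _).
  rewrite monicE lead_coef_comp ?size_XaddC //.
  rewrite (monicP (monicXaddC _)) expr1n mulr1.
  by rewrite (monicP (monic_map _ Qm)).
have A0 : A != 0 by apply: mpoly_horner_neq0; apply: monic_neq0.
have B0 : B != 0 by apply: contraTneq FB => ->; rewrite rmorph0 monicE lead_coef0 eq_sym oner_eq0.
move=> x y e; have := congr1 F e; rewrite !rmorphM FA mul_polyC => eF.
have dvd : F B %| F x by rewrite -(dvdpZr _ _ A0) eF dvdp_mulr.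
have [w ew] := Pdiv.IdomainMonic.dvdpP FB _ dvd.
have ex : x = B * w.['X_j] by rewrite -[x]FK ew hornerM FK mulrC.
exists w.['X_j]; split=> //; apply: (mulfI B0).
by rewrite -e {1}ex mulrCA.
Qed.

End Coprime.

(** * Gluing quotients along the edges *)

Section Glue.
Variables (k : fieldType) (n : nat) (G : rel 'I_n).
Local Notation S := {mpoly k[n]}.
Implicit Types (f g p q u : S) (a b c m : 'X_{1..n}) (i j s t v : 'I_n).
Local Notation sq T := (monomial_span (k := k) (fun a => (1 < weight_off T a)%N)).

Hypothesis G_simple : simple_graph G.
Hypothesis G_diam : forall i j, i != j -> ~~ G i j -> exists t, G i t && G t j.

Lemma weight_off_sub (T T' : pred 'I_n) a : (forall x, T x -> T' x) ->
  (weight_off T' a <= weight_off T a)%N.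
Proof.
move=> TT'; rewrite /weight_off [X in (X <= _)%N]big_mkcond [X in (_ <= X)%N]big_mkcond.
apply: leq_sum => x _; case: (boolP (T x)) => [/TT'->//|_].
by case: (T' x).
Qed.

Lemma weight_off_pred1 i j a : i != j ->
  weight_off (pred1 i) a = (a j + weight_off (pred2 i j) a)%N.
Proof.
move=> ij; rewrite /weight_off (bigD1 j) /= 1?eq_sym //; congr (_ + _)%N.
by apply: eq_bigl => x; rewrite /= negb_or.
Qed.

(** One end has exponent 0; take the other one for [v]. Replacing the end of exponent 0 by any
    vertex cannot raise the weight. *)
Lemma exists_heavy_vertex i j a : i != j -> (a i + a j <= 1)%N ->
  exists2 v, v \in [:: i; j] & forall s t, v \in [:: s; t] ->
    (weight_off (pred2 s t) a <= weight_off (pred2 i j) a)%N.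
Proof.
move=> ij aij.
have sub v s t : v \in [:: s; t] -> (weight_off (pred2 s t) a <= weight_off (pred1 v) a)%N.
  by move=> vst; apply: weight_off_sub => x /eqP->; rewrite !inE in vst.
have [ai|aj] : a i = 0%N \/ a j = 0%N by move: aij; clear; lia.
  exists j; rewrite ?mem_seq2 ?eqxx ?orbT // => s t /sub/leq_trans; apply.
  rewrite (@weight_off_pred1 j i) 1?eq_sym // ai add0n; apply: weight_off_sub => x /=.
  by rewrite orbC.
exists i; rewrite ?mem_seq2 ?eqxx // => s t /sub/leq_trans; apply.
by rewrite (@weight_off_pred1 i j) // aj.
Qed.

Variables (p q : S).
Hypothesis pq_coprime : forall i j, G i j ->
  coprime_pair (weight_part (pred2 i j) 0 p) (weight_part (pred2 i j) 0 q).
Hypothesis p_neq0 : forall i j, G i j -> weight_part (pred2 i j) 0 p != 0.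
Hypothesis pq_axis : forall v, weight_part (pred1 v) 0 p != 0 \/ weight_part (pred1 v) 0 q != 0.

Local Notation symb_sqr :=
  (monomial_span (k := k) (fun a => forall i j, G i j -> (1 < weight_off (pred2 i j) a)%N)).

Lemma weight_part0_neq0 T f : weight_part T 0 f != 0 -> exists2 c, weight_off T c = 0%N & f@_c != 0.
Proof.
move=> f0; apply: contrapT => h; case/eqP: f0; apply/weight_part_eq0P => a wa.
by apply/eqP/negPn/negP => fa; apply: h; exists a.
Qed.

Lemma symb_sqr_nzd f : symb_sqr (p * f) -> symb_sqr f.
Proof.
move=> pf; suff h i j : G i j -> sq (pred2 i j) f by move=> a fa i j /h; apply.
move=> Gij; apply/sqP; have [c wc pc] := weight_part0_neq0 (p_neq0 Gij).
apply: (nzd_monomials (T := pred2 i j) (p := p) (c0 := c)) => //.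
- by move=> a b; rewrite weight_offD => /(leq_trans (leq_addr _ _)).
- by move=> a b wa wb; rewrite weight_offD wb.
- by move=> a wa; apply/eqP/negPn/negP => /pf/(_ i j Gij); rewrite ltnNge wa.
Qed.

(* One of p and q is a nonzerodivisor modulo the sum of the squares of the
   primes of two edges through v, so the quotients u and u' agree modulo it. *)
Lemma agree_at_vertex v i j s t g h u u' : v \in [:: i; j] -> v \in [:: s; t] ->
  sq (pred2 i j) (g - p * u) -> sq (pred2 i j) (h - q * u) ->
  sq (pred2 s t) (g - p * u') -> sq (pred2 s t) (h - q * u') ->
  forall a, (weight_off (pred2 i j) a <= 1)%N -> (weight_off (pred2 s t) a <= 1)%N ->
  u@_a = u'@_a.
Proof.
move=> vij vst gu hu gu' hu' a wa wa'.
pose N b := (weight_off (pred2 i j) b <= 1)%N /\ (weight_off (pred2 s t) b <= 1)%N.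
suff : (u' - u)@_a = 0 by rewrite mcoeffB => /eqP; rewrite subr_eq0 => /eqP.
have main r x : sq (pred2 i j) (x - r * u) -> sq (pred2 s t) (x - r * u') ->
    weight_part (pred1 v) 0 r != 0 -> (u' - u)@_a = 0.
  move=> xu xu' /weight_part0_neq0[c wc rc].
  apply: (nzd_monomials (T := pred1 v) (N := N) (p := r) (c0 := c)) => //.
  - move=> b d []; rewrite !weight_offD => *.
    by split; apply: leq_trans (leq_addr _ _) _; eassumption.
  - move=> b d [wb wb'] wd; rewrite /N !weight_offD.
    have sub y z : v \in [:: y; z] -> weight_off (pred2 y z) d = 0%N.
      move=> vyz; apply/eqP; rewrite -leqn0 -wd; apply: weight_off_sub => w /eqP->.
      by rewrite !inE in vyz.
    by rewrite !sub.
  - move=> b [wb wb'].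
    have -> : r * (u' - u) = (x - r * u) - (x - r * u') by ring.
    rewrite mcoeffB; move/sqP: xu => ->//; move/sqP: xu' => ->//.
    by rewrite subrr.
by have [/(main p g gu gu')|/(main q h hu hu')] := pq_axis v.
Qed.

Lemma symb_sqr_regular g h : symb_sqr (q * g - p * h) -> exists u, symb_sqr (g - p * u).
Proof.
have [Gsym Girr Gnb] := G_simple => gh.
have /choice[u hu] : forall e : 'I_n * 'I_n, exists u, G e.1 e.2 ->
    sq (pred2 e.1 e.2) (g - p * u) /\ sq (pred2 e.1 e.2) (h - q * u).
  move=> [i j]; have [Gij|nG] := boolP (G i j); last by exists 0.
  have [|u hu] := sq_coprime (pq_coprime Gij) (g := g) (h := h); last by exists u.
  by move=> a /gh; apply.
pose ok a (e : 'I_n * 'I_n) := G e.1 e.2 && (weight_off (pred2 e.1 e.2) a <= 1)%N.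
have share v a e e' : ok a e -> ok a e' -> v \in [:: e.1; e.2] -> v \in [:: e'.1; e'.2] ->
    (u e)@_a = (u e')@_a.
  move=> /andP[/hu[g1 h1] w1] /andP[/hu[g2 h2] w2] v1 v2.
  exact: (agree_at_vertex v1 v2 g1 h1 g2 h2).
have agree a e e' : ok a e -> ok a e' -> (u e)@_a = (u e')@_a.
  move=> oke oke'; case: e e' oke oke' => [i j] [s t] oke oke'.
  have := oke; have := oke'; rewrite /ok /= => /andP[Gst wst] /andP[Gij wij].
  have [vs|nvs] := boolP (i \in [:: s; t]); first by apply: (share i); rewrite //= mem_head.
  have [vj|nvj] := boolP (j \in [:: s; t]).
    by apply: (share j); rewrite //= !inE eqxx orbT.
  have ij : i != j by apply: contraTneq Gij => ->; rewrite Girr.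
  have st : s != t by apply: contraTneq Gst => ->; rewrite Girr.
  (* For disjoint edges, the ends of one count in the weight off the other, so their exponents have
     sum at most 1 and [exists_heavy_vertex] applies to both edges. *)
  have two x y z w : x != y -> z \notin [:: x; y] -> w \notin [:: x; y] -> z != w ->
      (weight_off (pred2 x y) a <= 1)%N -> (a z + a w <= 1)%N.
    move=> xy; rewrite !inE => zxy wxy zw /(leq_trans _)->//.
    rewrite /weight_off (bigD1 z) //= (bigD1 w) /= ?wxy 1?eq_sym //.
    by rewrite addnA leq_addr.
  have [ns nt] : s \notin [:: i; j] /\ t \notin [:: i; j].
    move: nvs nvj; rewrite !inE !negb_or !(eq_sym s) !(eq_sym t).
    by move=> /andP[-> ->] /andP[-> ->].
  have [v vij hv] := exists_heavy_vertex ij (two s t i j st nvs nvj ij wst).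
  have [w wst' hw] := exists_heavy_vertex st (two i j s t ij ns nt st wij).
  have vw : v != w.
    apply: contraTneq wst' => <-; move: vij; rewrite inE mem_seq1.
    by move=> /orP[]/eqP->.
  (* All edges through [v] or [w] are [ok], so the two given edges are linked through an edge from
     [v] to [w] or a common neighbour of them. *)
  have okv x : G v x -> ok a (v, x).
    by move=> Gvx; rewrite /ok /= Gvx (leq_trans (hv _ _ _) wij) // mem_head.
  have okw x : G x w -> ok a (x, w).
    by move=> Gxw; rewrite /ok /= Gxw (leq_trans (hw _ _ _) wst) // !inE eqxx orbT.
  have in1 (x y : 'I_n) : x \in [:: x; y] by rewrite mem_head.
  have in2 (x y : 'I_n) : y \in [:: x; y] by rewrite !inE eqxx orbT.
  have [Gvw|nGvw] := boolP (G v w).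
    apply: etrans (share v a (i, j) (v, w) oke (okv _ Gvw) vij (in1 _ _)) _.
    exact: (share w a (v, w) (s, t) (okv _ Gvw) oke' (in2 _ _) wst').
  have [x /andP[Gvx Gxw]] := G_diam vw nGvw.
  apply: etrans (share v a (i, j) (v, x) oke (okv _ Gvx) vij (in1 _ _)) _.
  apply: etrans (share x a (v, x) (x, w) (okv _ Gvx) (okw _ Gxw) (in2 _ _) (in1 _ _)) _.
  exact: (share w a (x, w) (s, t) (okw _ Gxw) oke' (in2 _ _) wst').
(* The bound [B] on all degrees makes the family of chosen coefficients finite, hence a
   polynomial. *)
pose B := (\sum_e msize (u e))%N.
have uB e a : (B <= mdeg a)%N -> (u e)@_a = 0.
  move=> Ba; apply/memN_msupp_eq0/msize_mdeg_ge/(leq_trans _ Ba).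
  by rewrite /B (bigD1 e) //= leq_addr.
(* By [agree] the edge picked does not matter; if there is none, x^a lies in J and 0 will do. *)
pose U a := if [pick e | ok a e] is Some e then (u e)@_a else 0.
pose v := \sum_(m : 'X_{1..n < B}) (U m *: 'X_[m]) : S.
have vE a e : ok a e -> v@_a = (u e)@_a.
  move=> oke; have [aB|aB] := ltnP (mdeg a) B.
    rewrite /v mcoeff_mpoly // /U; case: pickP => [e' oke'|/(_ e)]; last by rewrite oke.
    exact: agree.
  rewrite uB // /v raddf_sum big1 //= => m _; rewrite mcoeffZ mcoeffX.
  case: eqP => [em|]; last by rewrite mulr0.
  by have := bmdeg m; rewrite em ltnNge aB.
exists v => a ha i j Gij.
have [h1 _] := hu (i, j) Gij.
have : sq (pred2 i j) (g - p * v); last exact.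
have -> : g - p * v = (g - p * u (i, j)) + p * (u (i, j) - v) by ring.
have [_ hD hM] := sq_ideal k (pred2 i j).
apply: hD => //; apply: hM; apply/sqP => b wb.
by rewrite mcoeffB (vE b (i, j)) ?subrr // /ok Gij.
Qed.

End Glue.

(** * The theorem *)


Section ColorClasses.
Variables (k : fieldType) (n : nat).
Local Notation S := {mpoly k[n]}.
Implicit Types (P Q : {poly k}) (i j t v : 'I_n) (b d : pred 'I_n).

Definition var_sum b : S := \sum_(t | b t) 'X_t.

Lemma rmorph_var_sum (T : comNzRingType) (f : {rmorphism S -> T}) b i j : i != j ->
  (forall t, t != i -> t != j -> f 'X_t = 0) ->
  f (var_sum b) = (if b i then f 'X_i else 0) + (if b j then f 'X_j else 0).
Proof.
move=> ij f0; rewrite rmorph_sum big_mkcond (bigD1 i) //= (bigD1 j) 1?eq_sym //=.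
rewrite big1 ?addr0 // => t /andP[ti tj].
by case: (b t) => //; apply: f0.
Qed.

(** The part of weight 0 is obtained by substituting 0 for the variables outside [T]. *)
Lemma weight_part0_rmorph (T : pred 'I_n) : exists f : {rmorphism S -> S},
  [/\ weight_part T 0 =1 f, forall c, f c%:MP = c%:MP &
      forall t, f 'X_t = if T t then 'X_t else 0].
Proof.
exists (horner_eval 0 \o off_grading k T); split=> [x|c|t].
- by rewrite weight_partE -horner_coef0.
- rewrite -[LHS]/((off_grading k T _).[0]) (_ : off_grading k T c%:MP = (c%:MP)%:P) ?hornerC //.
  exact: mmapC.
- rewrite -[LHS]/((off_grading k T _).[0]) off_gradingX weight_offU hornerM hornerC hornerXn.
  by case: (T t); rewrite /= ?expr0 ?expr1 ?mulr1 ?mulr0.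
Qed.

Lemma weight_part0_mpoly_horner (T : pred 'I_n) P x :
  weight_part T 0 (mpoly_horner P x) = mpoly_horner P (weight_part T 0 x).
Proof.
have [f [fE fC _]] := weight_part0_rmorph T.
by rewrite !fE rmorph_mpoly_horner /mpoly_horner; congr (_.[_]); apply: eq_map_poly.
Qed.

Lemma weight_part0_var_sum2 b i j : i != j ->
  weight_part (pred2 i j) 0 (var_sum b) = (if b i then 'X_i else 0) + (if b j then 'X_j else 0).
Proof.
move=> ij; have [f [fE _ fX]] := weight_part0_rmorph (pred2 i j).
rewrite fE (rmorph_var_sum b ij); first by rewrite !fX /= !eqxx orbT.
by move=> t ti tj; rewrite fX /= (negPf ti) (negPf tj).
Qed.

Lemma weight_part0_var_sum1 b v : weight_part (pred1 v) 0 (var_sum b) = if b v then 'X_v else 0.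
Proof.
have [f [fE _ fX]] := weight_part0_rmorph (pred1 v).
rewrite fE rmorph_sum big_mkcond (bigD1 v) //= big1 ?addr0; first by rewrite fX /= eqxx.
by move=> t tv; rewrite fX /= (negPf tv) if_same.
Qed.

Lemma weight_part0_var_sum_neq0 P b i j : i != j -> P \is monic -> b i ->
  weight_part (pred2 i j) 0 (mpoly_horner P (var_sum b)) != 0.
Proof.
move=> ij /monic_neq0 P0 bi; rewrite weight_part0_mpoly_horner weight_part0_var_sum2 // bi.
have [f [_ fC fX]] := weight_part0_rmorph (pred1 i).
have fij : f ('X_i + (if b j then 'X_j else 0)) = 'X_i.
  rewrite rmorphD fX /= eqxx.
  by case: (b j); rewrite ?rmorph0 ?addr0 // fX /= eq_sym (negPf ij) addr0.
apply: contra_neq (mpoly_horner_neq0 i P0) => /(congr1 f).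
rewrite rmorph_mpoly_horner rmorph0 fij (eq_map_poly (g := @mpolyC n k)) //.
Qed.

(** The vectors (b, c) at [i] and [j] are nonzero and distinct with entries 0 and 1, so the two
    linear forms are independent over any field. Exchanging the variables or the forms reduces the
    six cases to [coprime_horner] with scalar 0 or 1. *)
Lemma coprime_pair_colors P Q i j b (c : pred 'I_n) : i != j -> P \is monic -> Q \is monic ->
  b i || c i -> b j || c j -> (b i != b j) || (c i != c j) ->
  coprime_pair (mpoly_horner P ((if b i then 'X_i else 0) + (if b j then 'X_j else 0) : S))
    (mpoly_horner Q ((if c i then 'X_i else 0) + (if c j then 'X_j else 0))).
Proof.
move=> ij Pm Qm; have ji : j != i by rewrite eq_sym.
case: (b i); case: (c i); case: (b j); case: (c j) => //= _ _ _; rewrite ?add0r ?addr0.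
- by apply: coprime_pairC; have := coprime_horner (b := 1) ij Qm Pm; rewrite scale1r.
- by have := coprime_horner (b := 1) ij Pm Qm; rewrite scale1r.
- by apply: coprime_pairC; have := coprime_horner (b := 1) ji Qm Pm; rewrite scale1r addrC.
- by have := coprime_horner (b := 0) ij Pm Qm; rewrite scale0r add0r.
- by have := coprime_horner (b := 1) ji Pm Qm; rewrite scale1r addrC.
- by have := coprime_horner (b := 0) ji Pm Qm; rewrite scale0r add0r.
Qed.

End ColorClasses.

(** * The two implications *)

Section Main.
Variables (k : fieldType) (n : nat) (G : rel 'I_n).
Local Notation S := {mpoly k[n]}.
Local Notation K2 := (monomial_span (k := k) (nonface2 G)).
Hypothesis G_simple : simple_graph G.

Lemma nonface2_ideal : is_ideal K2.
Proof. by apply: monomial_span_ideal => a b; apply: nonface2D. Qed.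

Lemma exists_edge : (0 < n)%N -> exists i j, G i j.
Proof.
by move=> n_gt0; have [_ _ /(_ (Ordinal n_gt0))[j Gj]] := G_simple; exists (Ordinal n_gt0), j.
Qed.

Lemma nonface2_proper : (0 < n)%N -> ~ K2 1.
Proof.
move=> /exists_edge[i [j Gij]] /(_ 0%MM); rewrite mcoeff1 eqxx oner_eq0 => /(_ isT).
move=> [b [c [/(_ i j Gij) hb _ /(congr1 (weight_off (pred2 i j)))]]].
by rewrite weight_off0 weight_offD => e; move: hb; rewrite lt0n; case: (weight_off _ b) e.
Qed.

Variables (R : comNzRingType) (p : {rmorphism S -> R}).
Hypotheses (p_surj : forall y, exists x, p x = y) (p_ker : forall x, p x = 0 <-> K2 x).

Lemma cohen_macaulay_cycle : (4 <= n)%N -> cohen_macaulay R -> is_cycle G 4 \/ is_cycle G 5.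
Proof.
move=> n4 [_ CM]; have [Gsym Girr Gnb] := G_simple.
have [i [j Gij]] := exists_edge (leq_trans (isT : 0 < 4)%N n4).
have neq x y : G x y -> x != y by move=> h; apply: contraTneq h => ->; rewrite Girr.
pose f : {rmorphism S -> k} := mcoeff 0%MM.
have fX t : f 'X_t = 0 by rewrite /= mcoeffX mnm1_eq0.
have fK x : K2 x -> f x = 0 by apply: rmorph_nonface2 Gij _ x.
have [m_ideal m1 _] := (prime_idealP _).1 (image_ker_prime p_surj p_ker fK).
have m_max : maximal_ideal (image_ker p f).
  apply/maximal_idealP; split=> // y; have [x <-] := p_surj y => nx.
  have fx : f x != 0 by apply/eqP => fx; apply: nx; exists x.
  exists (p (f x)^-1%:MP); rewrite -(rmorph1 p) -rmorphM -rmorphB.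
  exists ((f x)^-1%:MP * x - 1) => //.
  by rewrite rmorphB rmorphM rmorph1 /= mpolyCK mulVf ?subrr.
have [d [[s s_reg [sm sd]] _] [_ hh]] := CM _ m_max.
(* The origin lies on the plane of any edge, which gives a chain of primes of length 2; the depth
   equals the height, so it is at least 2 as well. *)
have : (2 <= d)%N.
  by apply/hh/(height_ge2 p_surj p_ker (neq _ _ Gij) Gij); rewrite ?fX //; exact: algebraic0.
case: s s_reg sm sd => [|a [|b s]] s_reg sm <- // _.
have [x px fx] : image_ker p f a by apply: sm; rewrite /= inE eqxx.
have [y py fy] : image_ker p f b by apply: sm; rewrite /= !inE eqxx orbT.
rewrite -px -py in s_reg.
have glue := depth2_glueing p_surj p_ker fx fy s_reg.
apply: is_cycle_4_5 => //.
  move=> v r t u Gr Gt Gu; apply: (glueing_degree glue Gr Gt Gu); exact: neq.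
exact: (glueing_common_neighbour glue G_simple).
Qed.

Lemma cycle_cohen_macaulay : is_cycle G 4 \/ is_cycle G 5 -> cohen_macaulay R.
Proof.
move=> /(cycle_4_5_properties G_simple)[G_nonface2 G_diam [col colP]].
have [Gsym Girr Gnb] := G_simple.
have dim2 : krull_dim_le2 R.
  by apply: (krull_dim_le2_nonface2 Girr p_surj) => x /p_ker.
split; first exact: noetherian_surj p_surj (@noetherian_mpoly k n).
move=> m m_max.
have [K [f [i [j [em ij Gij f0 [algi algj]]]]]] :=
  maximal_ideal_residue p_surj p_ker Girr m_max.
exists 2; last first.
  split=> [|l]; last exact: krull_height.
  by rewrite em; apply: (height_ge2 p_surj p_ker ij Gij).
split=> [|l [s s_reg [_ <-]]]; last exact: krull_depth s_reg.
(* The colours 0, 1, 2 give the vectors (0, 1), (1, 0), (1, 1) as values of (b, c). *)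
pose b t := col t != 0; pose c t := col t != 1.
have alg d : exists2 P, P \is monic & f (mpoly_horner P (var_sum k d)) = 0.
  have alg_d : algebraicOver (f \o @mpolyC n k) (f (var_sum k d)).
    rewrite (rmorph_var_sum d ij f0).
    by apply: algebraic_add; case: ifP => _ //; exact: algebraic0.
  have [P Pm /eqP Pd] := (integral_algebraic _ _).1 alg_d.
  by exists P; rewrite // rmorph_mpoly_horner.
have [P Pm fP] := alg b; have [Q Qm fQ] := alg c.
set P' := mpoly_horner P _ in fP; set Q' := mpoly_horner Q _ in fQ.
have bc t : b t || c t by rewrite /b /c; case: (col t) => [[|[|]]].
(* This is the equality of J with I^2. *)
have symbK x : monomial_span (k := k)
    (fun a => forall i j, G i j -> (1 < weight_off (pred2 i j) a)%N) x <-> K2 x.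
  split=> hx a /hx; first exact: G_nonface2.
  move=> [d [e [hd he ->]]] s t Gst; rewrite weight_offD.
  by have := hd s t Gst; have := he s t Gst; clear; lia.
have neq x y : G x y -> x != y by move=> h; apply: contraTneq h => ->; rewrite Girr.
have cop s t : G s t ->
    coprime_pair (weight_part (pred2 s t) 0 P') (weight_part (pred2 s t) 0 Q').
  move=> Gst; rewrite !weight_part0_mpoly_horner !weight_part0_var_sum2 ?neq //.
  apply: coprime_pair_colors; rewrite ?neq //.
  have := colP s t Gst; rewrite /b /c.
  by case: (col s) => [[|[|[|//]]] ?]; case: (col t) => [[|[|[|//]]] ?].
have P'0 s t : G s t -> weight_part (pred2 s t) 0 P' != 0.
  move=> Gst; have [bs|nbs] := boolP (b s).
    exact: weight_part0_var_sum_neq0 (neq _ _ Gst) Pm bs.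
  have bt : b t.
    by have := colP s t Gst; move: nbs; rewrite /b negbK => /eqP->; rewrite eq_sym.
  have -> : weight_part (pred2 s t) 0 P' = weight_part (pred2 t s) 0 P'.
    apply/mpolyP => a; rewrite !mcoeff_weight_part.
    suff -> : weight_off (pred2 s t) a = weight_off (pred2 t s) a by [].
    by apply: eq_bigl => x /=; rewrite orbC.
  by apply: weight_part0_var_sum_neq0 => //; rewrite eq_sym neq.
have axis v : weight_part (pred1 v) 0 P' != 0 \/ weight_part (pred1 v) 0 Q' != 0.
  rewrite !weight_part0_mpoly_horner !weight_part0_var_sum1.
  by case/orP: (bc v) => ->; [left|right]; apply: mpoly_horner_neq0; exact: monic_neq0.
have [m_ideal m1 _] := (maximal_idealP m).1 m_max.
have sm : [set` [:: p P'; p Q']] `<=` m.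
  by move=> y /=; rewrite em !inE => /orP[]/eqP->; [exists P'|exists Q'].
exists [:: p P'; p Q']; last by [].
apply: regular_sequence2P.
- move=> y; have [x <-] := p_surj y; rewrite -rmorphM => /p_ker/symbK.
  by move=> /(symb_sqr_nzd P'0)/symbK/p_ker.
- move=> y z; have [g <-] := p_surj y; have [h <-] := p_surj z.
  rewrite -!rmorphM => /eqP; rewrite -subr_eq0 -rmorphB => /eqP/p_ker/symbK.
  move=> /(symb_sqr_regular G_simple G_diam cop axis)[u /symbK/p_ker/eqP].
  by rewrite rmorphB rmorphM subr_eq0 => /eqP->; exists (p u).
- by move=> /(ideal_gen_min m_ideal sm).
Qed.

End Main.

Local Close Scope ring_scope.
Local Close Scope classical_set_scope.

Theorem corollary3p4 (k : fieldType) (n : nat) (G : rel 'I_n)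
    (n_ge4 : 4 <= n) (simpleG : simple_graph G) :
  cohen_macaulay_ideal (ideal_pow (graph_ideal G k) 2) <->
  (is_cycle G 4 \/ is_cycle G 5).
Proof.
split=> [[J eJ CM]|cyc].
  have [f [f_surj f_ker]] := ideal_quot_morphism J.
  apply: (cohen_macaulay_cycle simpleG f_surj _ n_ge4 CM) => x.
  by rewrite f_ker -graph_ideal_sqrE eJ.
have nP := nonface2_proper (k := k) simpleG (leq_trans (isT : 0 < 4) n_ge4).
have [J eJ] := exists_idealr (nonface2_ideal k G) nP.
exists J; first by rewrite graph_ideal_sqrE.
have [f [f_surj f_ker]] := ideal_quot_morphism J.
apply: (cycle_cohen_macaulay simpleG f_surj _ cyc) => x.
by rewrite f_ker eJ.
Qed.
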